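(* There is an absolute constant $c_1>0$ such that the following holds with $c_0=21/32$. Assume the kernel $K$ is such that $\kappa_l=\min_{|u|\le1}K(u)>0$, and let the bandwidth satisfy $0<h\le\underline f/(4l_0)$. Given any $0<r\le h/(4\iota_{1/4})$ and any $t\ge0$, with probability at least $1-e^{-t}$, $$ \inf_{\boldsymbol\delta\in\Theta(r)\setminus\{0\}}\frac{D(\boldsymbol\beta^*+\boldsymbol\delta,\boldsymbol\beta^* )}{\kappa_l\|\boldsymbol\delta\|_{\boldsymbol\Sigma}^2}\ \ge\ c_0\underline f-c_1\left\{\bar f^{1/2}\,\frac1r\sqrt{\frac{ph}{n}}+(\bar fm_4)^{1/2}\sqrt{\frac{t}{nh}}+\frac{ht}{r^2n}\right\}. $$
   Context: Model: fix $\tau\in(0,1)$ and $p\ge 2$. Let $\boldsymbol x=(x_1,\dots,x_p)^{\top}$ be a random vector with $x_1\equiv1$ and $\mathbb E(x_j)=0$ for $j=2,\dots,p$, and $\boldsymbol\Sigma=\mathbb E(\boldsymbol x\boldsymbol x^{\top})$ positive definite. Let $y=\langle\boldsymbol x,\boldsymbol\beta^*\rangle+\varepsilon$ with $\boldsymbol\beta^*\in\mathbb R^p$ and $\mathbb P(\varepsilon\le0\mid\boldsymbol x)=\tau$; $f_{\varepsilon|\boldsymbol x}$ is the conditional density of $\varepsilon$ given $\boldsymbol x$. $(y_i,\boldsymbol x_i)$, $i=1,\dots,n$, are i.i.d. copies of $(y,\boldsymbol x)$. Definitions: $\mathcal K_h(u)=\int_{-\infty}^{u/h}K(v)\,dv$;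 the gradient of the convolution-smoothed empirical quantile loss is $\nabla\hat Q_h(\boldsymbol\beta)=\frac1n\sum_{i=1}^n\{\mathcal K_h(\langle\boldsymbol x_i,\boldsymbol\beta\rangle-y_i)-\tau\}\boldsymbol x_i$. The symmetrized Bregman divergence is $D(\boldsymbol\beta_1,\boldsymbol\beta_2)=\langle\nabla\hat Q_h(\boldsymbol\beta_1)-\nabla\hat Q_h(\boldsymbol\beta_2),\boldsymbol\beta_1-\boldsymbol\beta_2\rangle$. $\|\boldsymbol u\|_{\boldsymbol\Sigma}=\|\boldsymbol\Sigma^{1/2}\boldsymbol u\|_2$; $\Theta(r)=\{\boldsymbol u\in\mathbb R^p:\|\boldsymbol u\|_{\boldsymbol\Sigma}\le r\}$; $\boldsymbol w=\boldsymbol\Sigma^{-1/2}\boldsymbol x$; $m_4=\sup_{\|\boldsymbol u\|_2=1}\mathbb E\langle\boldsymbol u,\boldsymbol w\rangle^4$. For $\delta\in(0,1]$, $\iota_\delta=\inf\{\iota>0:\mathbb E\{\langle\boldsymbol u,\boldsymbol w\rangle^2\mathbf 1(|\langle\boldsymbol u,\boldsymbol w\rangle|>\iota)\}\le\delta\text{ for all unit vectors }\boldsymbol u\in\mathbb R^p\}$. Assumptions: (Kernel) $K$ is symmetric, non-negative, $\int K=1$, and $\sup_uK(u)<\infty$. (Density) There are constants $\bar f\ge\underline f>0$, $l_0>0$ such that, almost surely, $\underline f\le f_{\varepsilon|\boldsymbol x}(0)\le\bar f$ and $|f_{\varepsilon|\boldsymbol x}(u)-f_{\varepsilon|\boldsymbol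 x}(v)|\le l_0|u-v|$ for all $u,v\in\mathbb R$. (Sub-exponential design) There is $\upsilon_0>0$ such that $\mathbb P(|\langle\boldsymbol u,\boldsymbol w\rangle|\ge\upsilon_0t)\le2e^{-t}$ for all unit vectors $\boldsymbol u\in\mathbb R^p$ and $t\ge0$. *)

(* Defs.v *)
From HB Require Import structures.
From mathcomp Require Import all_boot all_order all_algebra.
From mathcomp Require Import all_classical all_reals all_analysis.
From mathcomp Require Import measurable_realfun.

Set Implicit Arguments.
Unset Strict Implicit.
Unset Printing Implicit Defensive.

Import Order.TTheory GRing.Theory Num.Theory.
Import numFieldNormedType.Exports.

Local Open Scope classical_set_scope.
Local Open Scope ring_scope.

(* Random vectors take values in [p.-tuple R], which carries the product
   (Borel) sigma-algebra; linear algebra is done on column vectors. *)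
Definition colv (R : realType) (p : nat) (v : p.-tuple R) : 'cV[R]_p :=
  \col_j tnth v j.

Definition dot (R : realType) (p : nat) (u v : 'cV[R]_p) : R :=
  \sum_j u j 0 * v j 0.

Definition norm2 (R : realType) (p : nat) (u : 'cV[R]_p) : R :=
  Num.sqrt (dot u u).

Definition posdef (R : realType) (p : nat) (A : 'M[R]_p) : Prop :=
  A^T = A /\ forall u : 'cV[R]_p, u != 0 -> 0 < dot u (A *m u).

Definition possemidef (R : realType) (p : nat) (A : 'M[R]_p) : Prop :=
  A^T = A /\ forall u : 'cV[R]_p, 0 <= dot u (A *m u).

(* The principal square root: the unique positive semidefinite [B] with
   [B *m B = A] when [A] is positive semidefinite, and [0] if there is none. *)
Definition mxsqrt (R : realType) (p : nat) (A : 'M[R]_p) : 'M[R]_p :=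
  xget 0 [set B | possemidef B /\ B *m B = A].

(* [g \o X] is a version of the conditional probability of [E] given [X]. *)
Definition is_cond_prob (d d' : measure_display) (T : measurableType d)
    (S : measurableType d') (R : realType) (P : probability T R)
    (E : set T) (X : T -> S) (g : S -> \bar R) : Prop :=
  measurable_fun setT g /\
  forall A : set S, measurable A ->
    (P (E `&` X @^-1` A) = \int[P]_(w in X @^-1` A) g (X w))%E.

(* [f v] is the conditional density of [Y] given [X = v]. *)
Definition is_cond_density (d d' : measure_display) (T : measurableType d)
    (S : measurableType d') (R : realType) (P : probability T R)
    (Y : T -> R) (X : T -> S) (f : S -> R -> R) : Prop :=
  [/\ measurable_fun setT (fun vu : S * R => f vu.1 vu.2),
      forall v u, 0 <= f v u &
      forall B : set R, measurable B ->
        is_cond_prob P (Y @^-1` B) X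
          (fun v => \int[lebesgue_measure]_(u in B) (f v u)%:E)%E].

(* Taking [B i = setT] in the product rule gives every subfamily. *)
Definition iid_copies (d d' : measure_display) (T : measurableType d)
    (S : measurableType d') (R : realType) (P : probability T R) (n : nat)
    (Z : 'I_n -> T -> S) (Z0 : T -> S) : Prop :=
  (forall (i : 'I_n) (B : set S), measurable B ->
     P (Z i @^-1` B) = P (Z0 @^-1` B)) /\
  (forall B : 'I_n -> set S, (forall i, measurable (B i)) ->
     P [set w | forall i, B i (Z i w)] = (\prod_(i < n) P (Z i @^-1` B i))%E).

Section Design.
Context {d : measure_display} {T : measurableType d} {R : realType}.
Context (P : probability T R) {p : nat} (x : T -> p.-tuple R).

Definition Sigma : 'M[R]_p :=
  \matrix_(j, k) fine 'E_P[fun w => (tnth (x w) j * tnth (x w) k)%R]%E.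

Definition normSigma (u : 'cV[R]_p) : R := norm2 (mxsqrt Sigma *m u).

Definition Theta (r : R) : set 'cV[R]_p := [set u | normSigma u <= r].

Definition whitened (w : T) : 'cV[R]_p := invmx (mxsqrt Sigma) *m colv (x w).

Definition m4 : \bar R :=
  ereal_sup [set 'E_P[fun w => (dot u (whitened w) ^+ 4)%R]%E
            | u in [set u : 'cV[R]_p | norm2 u = 1]].

Definition iota_trunc (delta : R) : R :=
  inf [set c : R | 0 < c /\ forall u : 'cV[R]_p, norm2 u = 1 ->
    ('E_P[fun w => (dot u (whitened w) ^+ 2
                    * \1_[set w' | c < `|dot u (whitened w')|] w)%R]
      <= delta%:E)%E].

Definition subexp_design (v0 : R) : Prop :=
  forall (u : 'cV[R]_p) (t : R), norm2 u = 1 -> 0 <= t ->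
    (P [set w | (v0 * t <= `|dot u (whitened w)|)%R] <= (2 * expR (- t))%:E)%E.

End Design.

Definition is_kernel (R : realType) (K : R -> R) : Prop :=
  [/\ measurable_fun setT K,
      forall u, K (- u) = K u,
      forall u, 0 <= K u,
      (\int[lebesgue_measure]_u (K u)%:E = 1)%E &
      has_ubound (range K)].

(* [inf] rather than a minimum, since [K] need not be continuous. *)
Definition kappa_l (R : realType) (K : R -> R) : R :=
  inf [set K u | u in [set u | `|u| <= 1]].

Definition smoothK (R : realType) (K : R -> R) (h u : R) : R :=
  \int[lebesgue_measure]_(v in `]-oo, u / h]) K v.

Definition gradQ (R : realType) (K : R -> R) (h tau : R) (n p : nat)
    (ys : 'I_n -> R) (xs : 'I_n -> 'cV[R]_p) (b : 'cV[R]_p) : 'cV[R]_p :=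
  n%:R^-1 *: \sum_(i < n) (smoothK K h (dot (xs i) b - ys i) - tau) *: xs i.

Definition bregman (R : realType) (K : R -> R) (h tau : R) (n p : nat)
    (ys : 'I_n -> R) (xs : 'I_n -> 'cV[R]_p) (b1 b2 : 'cV[R]_p) : R :=
  dot (gradQ K h tau ys xs b1 - gradQ K h tau ys xs b2) (b1 - b2).

(* Main.v *)
Require Import Defs.
From HB Require Import structures.
From mathcomp Require Import all_boot all_order all_algebra.
From mathcomp Require Import all_classical all_reals all_analysis.
From mathcomp Require Import measurable_realfun ring lra.

Set Implicit Arguments.
Unset Strict Implicit.
Unset Printing Implicit Defensive.

Import Order.TTheory GRing.Theory Num.Theory.
Import numFieldNormedType.Exports.

Local Open Scope classical_set_scope.
Local Open Scope ring_scope.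

(** Write [w] for the whitened design vector, [m = h / (4 * r)], and [chi] for
    the indicator of [`|eps| <= h / 2].  For [delta] in [Theta r], put
    [u = B delta / |B delta|] with [B] the square root of [Sigma].

    Deterministic part.  The divergence is a sum of nonnegative terms, each an
    integral of the kernel over a window of length [`|<x_i, delta>| / h] times
    [`|<x_i, delta>|].  When [`|eps_i| <= h / 2] and [`|<u, w_i>| <= 2 * m] the
    window lies in [[-1, 1]], where the kernel is at least [kappa_l K]
    ([smoothK_increment_ge]).  The normalised divergence is therefore at least
    the average of [chi_i <u, w_i>^2 1(`|<u, w_i>| <= 2 * m) / h].

    Expectation.  Given the design, [chi] has probability at least
    [29 / 32 * flow * h], and truncating [<u, w>^2] at a level close to
    [iota_(1/4)] leaves at least [3 / 4] of its mean.  The product [87 / 128] of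
    the two fractions exceeds [21 / 32], so a small constant factor can be lost.

    Uniform lower tail ([truncsq_sum_lower_tail]).  For a bounded nonnegative
    variable the loss of a constant factor makes a lower tail bound as cheap as
    it can be: if [lam * Z] stays below a small constant, then
    [E exp (- lam Z) <= exp (- (1 - eta) lam E Z)], so a direction to which a
    cost [L] is assigned loses only a multiple of [m^2 (t + L) / n].  The points
    of the grid [dl * Z^p] receive a cost that grows with their l1-norm, and one
    Markov inequality for a weighted sum of exponentials serves all grid points
    ([uniform_exponential_bound]).  A unit vector [u] is reached by rounding its
    coordinates to the grid at random, independently and without bias, and by
    averaging the inequalities over the rounding.  The average cost is at most
    [3 p + dl^-2] and the mean square error of [<u, w>] is at most
    [dl^2 |w|^2] ([unit_vector_rounding]); the truncated squares at the grid
    point and at [u], taken at slightly different levels, differ by a factor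
    close to one plus a multiple of this error ([truncsq_perturb]).
    Averaging the error before taking a supremum is what keeps logarithms of [p]
    out.

    Rates ([rate_arithmetic]).  With [A = sqrt fup / r * sqrt (p h / n)] and
    [dl^2] of order [flow / (fup p)], the errors cost a small fraction of [flow]
    and the average cost is of order [A^2 / flow].  Nothing has to be proved
    when [A] exceeds a small multiple of [flow], the divergence being
    nonnegative; otherwise [A^2 / flow] is at most a multiple of [A].

    The event is an intersection over uncountably many [delta]; continuity of
    the divergence reduces it to rational vectors, which makes it measurable
    ([bregman_event_measurable]). *)

(** * Comparing and factoring expectations *)

Section weighted_transfer.
Context {d d' : measure_display} {T : measurableType d}
  {S : measurableType d'} {R : realType} (mu : {measure set T -> \bar R}).
Local Open Scope ereal_scope.

Import HBNNSimple.

Let integral_weight_simple (G : T -> R) (X : T -> S) (F : {nnsfun S >-> R}) :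
  measurable_fun setT G -> (forall w, (0 <= G w)%R) -> measurable_fun setT X ->
  \int[mu]_w ((G w)%:E * (F (X w))%:E) =
  \sum_(k \in range F)
    k%:E * \int[mu]_(w in X @^-1` (F @^-1` [set k])) (G w)%:E.
Proof.
move=> mG G0 mX.
have mXF k : measurable (X @^-1` (F @^-1` [set k])).
  by rewrite -[X in measurable X]setTI; exact: mX.
have mGE : measurable_fun setT (EFin \o G) by exact/measurable_EFinP.
transitivity (\int[mu]_w \sum_(k \in range F)
    (k%:E * ((EFin \o G) \_ (X @^-1` (F @^-1` [set k]))) w)).
  apply: eq_integral => w _.
  rewrite fimfunE -fsumEFin// ge0_mule_fsumr//; last first.
    by move=> k; rewrite nnfun_muleindic_ge0.
  apply: eq_fsbigr => k _; rewrite EFinM muleCA patchE indicE.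
  have -> : (X w \in F @^-1` [set k]) = (w \in X @^-1` (F @^-1` [set k])).
    by apply/idP/idP; rewrite !inE.
  by case: ifPn => _; rewrite ?mule1// mule0.
have k0 k : k \in range F -> (0 <= k)%R.
  by rewrite inE => -[s _ <-].
have mGk k : measurable_fun setT
    ((EFin \o G) \_ (X @^-1` (F @^-1` [set k]))).
  apply/(measurable_restrict _ (mXF k) measurableT).
  by rewrite setTI; exact: measurable_funS mGE.
rewrite (_ : (fun w => _) = (fun w => \sum_(k \in range F)
    (if (0 <= k)%R then k%:E else 0) *
      ((EFin \o G) \_ (X @^-1` (F @^-1` [set k]))) w)); last first.
  by apply/funext => w; apply: eq_fsbigr => k /k0 ->.
rewrite ge0_integral_fsum//; last 2 first.
- by move=> k; exact: measurable_funeM.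
- move=> k w _; apply: mule_ge0; first by case: ifP.
  by rewrite patchE; case: ifP => //= _; rewrite lee_fin.
apply: eq_fsbigr => k kF; rewrite k0// ge0_integralZl//; last 2 first.
- by move=> w _; rewrite patchE; case: ifP => //= _; rewrite lee_fin.
- by rewrite lee_fin k0.
by rewrite [in RHS]integral_mkcond.
Qed.

Let integral_weight_cvg (G : T -> R) (X : T -> S) (F : S -> \bar R)
    (mF : measurable_fun setT F) :
  measurable_fun setT G -> (forall w, (0 <= G w)%R) -> measurable_fun setT X ->
  (forall s, 0 <= F s) ->
  \int[mu]_w ((G w)%:E * (nnsfun_approx measurableT mF n (X w))%:E)
    @[n --> \oo] --> \int[mu]_w ((G w)%:E * F (X w)).
Proof.
move=> mG G0 mX F0; pose f_ := nnsfun_approx measurableT mF.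
have -> : \int[mu]_w ((G w)%:E * F (X w)) =
    \int[mu]_w limn (fun n => (G w)%:E * (f_ n (X w))%:E).
  apply: eq_integral => w _; apply/esym/cvg_lim => //.
  by apply: cvgeZl => //; exact: cvg_nnsfun_approx.
apply: cvg_monotone_convergence => //.
- move=> n; apply: emeasurable_funM; first exact/measurable_EFinP.
  by apply/measurable_EFinP; apply: measurableT_comp.
- by move=> n w _; rewrite mule_ge0// lee_fin.
- move=> w _ m n mn; rewrite lee_wpmul2l// lee_fin//.
  by move/(nd_nnsfun_approx measurableT mF): mn => /lefP; exact.
Qed.

(** Two weighted laws that compare on measurable sets compare on nonnegative
    functions: both integrals are increasing limits of the same nonnegative
    combinations of measures of level sets of simple functions. *)
Lemma le_integral_weight (G1 G2 : T -> R) (X1 X2 : T -> S) (F : S -> \bar R) :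
  measurable_fun setT G1 -> (forall w, (0 <= G1 w)%R) ->
  measurable_fun setT X1 ->
  measurable_fun setT G2 -> (forall w, (0 <= G2 w)%R) ->
  measurable_fun setT X2 ->
  measurable_fun setT F -> (forall s, 0 <= F s) ->
  (forall B, measurable B ->
    \int[mu]_(w in X1 @^-1` B) (G1 w)%:E <=
    \int[mu]_(w in X2 @^-1` B) (G2 w)%:E) ->
  \int[mu]_w ((G1 w)%:E * F (X1 w)) <= \int[mu]_w ((G2 w)%:E * F (X2 w)).
Proof.
move=> mG1 G10 mX1 mG2 G20 mX2 mF F0 H.
have c1 := integral_weight_cvg mF mG1 G10 mX1 F0.
have c2 := integral_weight_cvg mF mG2 G20 mX2 F0.
rewrite -(cvg_lim _ c1)// -(cvg_lim _ c2)//.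
apply: lee_lim; [by apply/cvg_ex; eexists; exact: c1
                |by apply/cvg_ex; eexists; exact: c2|].
near=> n; rewrite !integral_weight_simple//.
apply: lee_fsum => // k -[s _ <-].
apply: lee_wpmul2l; first by rewrite lee_fin.
exact: H.
Unshelve. all: by end_near. Qed.

End weighted_transfer.

Section iid_product.
Context {d d' : measure_display} {T : measurableType d}
  {S : measurableType d'} {R : realType} (P : probability T R).

Lemma integral_indic_comp (X : T -> S) (B : set S) (c : R) :
  measurable_fun setT X -> measurable B ->
  (\int[P]_(w in X @^-1` B) c%:E = (c * fine (P (X @^-1` B)))%:E)%E.
Proof.
move=> mX mB.
have mXB : measurable (X @^-1` B).
  by rewrite -[X in measurable X]setTI; exact: mX.
by rewrite integral_cst// EFinM fineK// fin_num_measure.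
Qed.

(** The product rule for sets passes to functions one factor at a time: once
    the first [k] indicators are replaced by [F], freezing all factors but the
    [k]-th leaves a weight whose law along [Z k] is known on every set. *)
Lemma iid_integral_prod_le n (Z : 'I_n -> T -> S) (Z0 : T -> S) (F : S -> R)
    (c : R) :
  iid_copies P Z Z0 -> (forall i, measurable_fun setT (Z i)) ->
  measurable_fun setT Z0 -> measurable_fun setT F -> (forall s, 0 <= F s) ->
  0 <= c -> (\int[P]_w (F (Z0 w))%:E <= c%:E)%E ->
  (\int[P]_w (\prod_(i < n) F (Z i w))%:E <= (c ^+ n)%:E)%E.
Proof.
move=> [Zid Zprod] mZ mZ0 mF F0 c0 Fc.
pose q i B := fine (P (Z i @^-1` B)).
have mZB i B : measurable B -> measurable (Z i @^-1` B).
  by move=> mB; rewrite -[X in measurable X]setTI; exact: mZ.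
have q0 i B : 0 <= q i B by rewrite fine_ge0.
pose g k (B : 'I_n -> set S) (i : 'I_n) w : R :=
  if (i < k)%N then F (Z i w) else \1_(Z i @^-1` B i) w.
pose e k (B : 'I_n -> set S) (i : 'I_n) : R :=
  if (i < k)%N then c else q i (B i).
have g0 k B i w : 0 <= g k B i w by rewrite /g; case: ifP.
have e0 k B i : 0 <= e k B i by rewrite /e; case: ifP.
have mg k B i : (forall i, measurable (B i)) -> measurable_fun setT (g k B i).
  move=> mB; rewrite /g; case: ltnP => _.
    exact: (measurableT_comp mF (mZ i)).
  by apply: measurable_indic; exact: mZB.
suff H k : (k <= n)%N -> forall B, (forall i, measurable (B i)) ->
    (\int[P]_w (\prod_(i < n) g k B i w)%:E <= (\prod_(i < n) e k B i)%:E)%E.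
  have := H n (leqnn n) (fun=> setT) (fun=> measurableT).
  under eq_bigr => i _ do rewrite /e ltn_ord.
  rewrite prodr_const card_ord => Hn.
  apply: le_trans Hn; rewrite le_eqVlt; apply/orP; left; apply/eqP.
  apply: eq_integral => w _; congr EFin.
  by apply: eq_bigr => i _; rewrite /g ltn_ord.
elim: k => [_ B mB|k IH kn B mB].
  rewrite (_ : (\prod_(i < n) e 0%N B i)%:E =
      P [set w | forall i, B i (Z i w)]); last first.
    rewrite Zprod// -prodEFin; apply: eq_bigr => i _.
    by rewrite /e /= fineK// fin_num_measure//; exact: mZB.
  have mI : measurable [set w | forall i, B i (Z i w)].
    rewrite (_ : mkset _ = \bigcap_(i in [set: 'I_n]) Z i @^-1` B i).
      apply: fin_bigcap_measurable => // i _; exact: mZB.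
    by apply/seteqP; split=> w /= h i; [move=> _; exact: h|exact: h].
  rewrite -(setIT [set w | forall i, B i (Z i w)]) -integral_indic//.
  rewrite le_eqVlt; apply/orP; left; apply/eqP.
  apply: eq_integral => w _; congr EFin.
  rewrite indicE; have [h|h] := pselect (forall i, B i (Z i w)).
    rewrite mem_set// big1// => i _.
    by rewrite /g /= indicE mem_set//; exact: h.
  rewrite memNset//; move/existsNP : h => [i hi].
  by rewrite (bigD1 i)//= /g /= indicE memNset// mul0r.
pose k' := Ordinal kn.
have neq_k' i : i != k' -> (val i == k) = false.
  by apply: contraNF => /eqP ik; exact/eqP/val_inj.
have gE B' w : \prod_(i < n) g k B' i w =
    (\prod_(i < n | i != k') g k B' i w) * \1_(B' k') (Z k' w).
  rewrite (bigD1 k')//= mulrC; congr (_ * _).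
  by rewrite /g /= ltnn !indicE.
have gE1 w : \prod_(i < n) g k.+1 B i w =
    (\prod_(i < n | i != k') g k B i w) * F (Z k' w).
  rewrite (bigD1 k')//= mulrC; congr (_ * _).
    by apply: eq_bigr => i ik; rewrite /g ltnS leq_eqVlt (neq_k' _ ik).
  by rewrite /g /= ltnSn.
have eE B' : \prod_(i < n) e k B' i =
    (\prod_(i < n | i != k') e k B' i) * q k' (B' k').
  by rewrite (bigD1 k')//= mulrC /e /= ltnn.
have eE1 : \prod_(i < n) e k.+1 B i = (\prod_(i < n | i != k') e k B i) * c.
  rewrite (bigD1 k')//= mulrC; congr (_ * _); last by rewrite /e /= ltnSn.
  by apply: eq_bigr => i ik; rewrite /e ltnS leq_eqVlt (neq_k' _ ik).
pose G w := \prod_(i < n | i != k') g k B i w.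
pose E := \prod_(i < n | i != k') e k B i.
have E0 : 0 <= E by exact: prodr_ge0.
have G0 w : 0 <= G w by exact: prodr_ge0.
have mG : measurable_fun setT G.
  rewrite /G; under eq_fun do rewrite -big_filter.
  by apply: measurable_prod => i _; exact: mg.
under eq_integral do rewrite gE1 EFinM.
rewrite eE1.
apply: (@le_trans _ _ (\int[P]_w (E%:E * (F (Z0 w))%:E))%E); last first.
  rewrite ge0_integralZl//; last 2 first.
  - by apply/measurable_EFinP; exact: (measurableT_comp mF mZ0).
  - by move=> w _; rewrite lee_fin.
  by rewrite EFinM lee_wpmul2l.
apply: (@le_integral_weight _ _ _ _ _ P G (cst E) (Z k') Z0 (EFin \o F)) => //.
  exact/measurable_EFinP.
move=> A mA.
pose BA i := if i == k' then A else B i.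
have mBA i : measurable (BA i) by rewrite /BA; case: ifP.
have GA w : \prod_(i < n | i != k') g k BA i w = G w.
  by apply: eq_bigr => i /negbTE ik; rewrite /g /BA ik.
have EA : \prod_(i < n | i != k') e k BA i = E.
  by apply: eq_bigr => i /negbTE ik; rewrite /e /BA ik.
have := IH (ltnW kn) BA mBA.
rewrite eE EA integral_indic_comp// /BA eqxx /q Zid//; apply: le_trans.
rewrite integral_mkcond le_eqVlt; apply/orP; left; apply/eqP.
apply: eq_integral => w _.
rewrite gE GA patchE /BA eqxx indicE.
have -> : (Z k' w \in A) = (w \in Z k' @^-1` A) by apply/idP/idP; rewrite !inE.
by case: ifP => _; rewrite ?mulr1 ?mulr0.
Qed.

End iid_product.

(** * Truncated squares and exponential inequalities *)

Section truncated_square.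
Context {R : realType}.
Implicit Types a b v eta C : R.

Definition truncsq a v : R := if `|v| <= a then v ^+ 2 else 0.

Lemma truncsq_ge0 a v : 0 <= truncsq a v.
Proof. by rewrite /truncsq; case: ifP => // _; rewrite sqr_ge0. Qed.

Lemma truncsq_le a v : truncsq a v <= a ^+ 2.
Proof.
rewrite /truncsq; case: ifP => [va|_]; last exact: sqr_ge0.
by rewrite -real_normK ?num_real// lerXn2r// nnegrE// (le_trans _ va).
Qed.

(** Homogeneity: truncating [<u, w>] at [a] controls the truncation of
    [<x, delta> = N * <u, w>] at any level above [N * a]. *)
Lemma truncsq_scale (N a a' s : R) : 0 < N -> N * a <= a' ->
  N ^+ 2 * truncsq a (N^-1 * s) <= truncsq a' s.
Proof.
move=> N0 Na; rewrite /truncsq; case: ifPn => [|_]; last first.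
  by rewrite mulr0; case: ifP => // _; exact: sqr_ge0.
rewrite normrM gtr0_norm ?invr_gt0// ler_pdivrMl// => sa.
by rewrite (le_trans sa Na) exprMn mulrA -exprMn divff ?gt_eqF// expr1n mul1r.
Qed.

Lemma sqr_addr_le eta v e : 0 < eta ->
  (v + e) ^+ 2 <= (1 + eta) * v ^+ 2 + (1 + eta^-1) * e ^+ 2.
Proof.
move=> e0; rewrite -subr_ge0.
have -> : (1 + eta) * v ^+ 2 + (1 + eta^-1) * e ^+ 2 - (v + e) ^+ 2 =
    eta^-1 * (eta * v - e) ^+ 2 by field; rewrite gt_eqF.
by rewrite mulr_ge0 ?sqr_ge0// invr_ge0 ltW.
Qed.

(** Raising the truncation level from [a] to [b] absorbs the perturbation: a
    point that crosses the gap has moved by at least [b - a], and then the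
    error term alone exceeds the bound [a ^+ 2] on the left-hand side. *)
Lemma truncsq_perturb a b eta C v v' : 0 < eta -> 0 <= a -> a <= b ->
  1 + eta^-1 <= C -> a ^+ 2 <= C * (b - a) ^+ 2 ->
  truncsq a v' <=
    (1 + eta) * truncsq b v + Num.min (C * (v' - v) ^+ 2) (a ^+ 2).
Proof.
move=> e0 a0 ab eC aC.
have C0 : 0 <= C by rewrite (le_trans _ eC)// addr_ge0// invr_ge0 ltW.
have b0 : 0 <= (1 + eta) * truncsq b v.
  by rewrite mulr_ge0 ?truncsq_ge0// addr_ge0// ltW.
rewrite -lerBlDl le_min; apply/andP; split; last first.
  by rewrite lerBlDl (le_trans (truncsq_le _ _))// lerDr.
rewrite {1}/truncsq; case: ifPn => [v'a|_]; last first.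
  by rewrite sub0r (@le_trans _ _ 0)// ?oppr_le0// mulr_ge0// sqr_ge0.
rewrite lerBlDl {1}/truncsq; case: ifPn => [_|].
  have := sqr_addr_le v (v' - v) e0; rewrite addrC subrK => /le_trans; apply.
  by rewrite lerD2l ler_wpM2r// sqr_ge0.
rewrite -ltNge => bv; rewrite mulr0 add0r.
have ge : b - a <= `|v' - v|.
  rewrite distrC (le_trans _ (lerB_dist _ _))// lerB// ltW//.
rewrite -[leLHS]real_normK ?num_real//.
rewrite (@le_trans _ _ (a ^+ 2))//; first by rewrite lerXn2r// nnegrE.
rewrite (le_trans aC)// ler_wpM2l// -[leRHS]real_normK ?num_real//.
by rewrite lerXn2r// nnegrE subr_ge0.
Qed.

Section average.
Context {I : finType} (rho : I -> R) (vz : I -> R).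
Hypotheses (rho0 : forall i, 0 <= rho i) (rho1 : \sum_i rho i = 1).

(** The truncation at [a ^+ 2] survives in the error term: it keeps that term
    bounded, so that it can enter an exponential moment. *)
Lemma truncsq_average_le a b eta C v : 0 < eta -> 0 <= a -> a <= b ->
  1 + eta^-1 <= C -> a ^+ 2 <= C * (b - a) ^+ 2 ->
  \sum_i rho i * truncsq a (vz i) <= (1 + eta) * truncsq b v
    + Num.min (C * \sum_i rho i * (vz i - v) ^+ 2) (a ^+ 2).
Proof.
move=> e0 a0 ab eC aC.
have avg c : \sum_i rho i * c = c by rewrite -mulr_suml rho1 mul1r.
have H i := truncsq_perturb v (vz i) e0 a0 ab eC aC.
rewrite -lerBlDl le_min; apply/andP; split; rewrite lerBlDl.
  rewrite mulr_sumr -[X in X + _](avg ((1 + eta) * _)) -big_split/=.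
  apply: ler_sum => i _; rewrite (mulrCA C) -mulrDr ler_wpM2l//.
  by apply: (le_trans (H i)); rewrite lerD2l ge_min lexx.
rewrite -[leRHS]avg.
apply: ler_sum => i _; rewrite ler_wpM2l//.
by apply: (le_trans (H i)); rewrite lerD2l ge_min lexx orbT.
Qed.

Lemma truncsq_le_average a b eta C v : 0 < eta -> 0 <= a -> a <= b ->
  1 + eta^-1 <= C -> a ^+ 2 <= C * (b - a) ^+ 2 ->
  truncsq a v <= (1 + eta) * (\sum_i rho i * truncsq b (vz i))
    + C * \sum_i rho i * (vz i - v) ^+ 2.
Proof.
move=> e0 a0 ab eC aC.
have -> : truncsq a v = \sum_i rho i * truncsq a v.
  by rewrite -mulr_suml rho1 mul1r.
rewrite !mulr_sumr -big_split/=.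
apply: ler_sum => i _; rewrite !(mulrCA _ (rho i)) -mulrDr ler_wpM2l//.
apply: (le_trans (truncsq_perturb (vz i) v e0 a0 ab eC aC)).
by rewrite lerD2l ge_min -sqrrN opprB lexx.
Qed.

End average.
End truncated_square.

Section exponential.
Context {R : realType}.

(** From [expR y <= (1 - y)^-1]: the quadratic term of the expansion is
    absorbed into the two linear ones because [a] and [b] are small. *)
Lemma expR_sub_le (a b : R) : 0 <= a <= 1 / 250 -> 0 <= b <= 1 / 250 ->
  expR (b - a) <= 1 - (199 / 200) * a + 2 * b.
Proof.
move=> /andP[a0 a1] /andP[b0 b1].
have x1 : 0 < 1 - (b - a) by lra.
have : expR (b - a) <= (1 - (b - a))^-1.
  rewrite -[b - a]opprK expRN lef_pV2 ?posrE ?expR_gt0//; last by lra.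
  by have := expR_ge1Dx (- (b - a)); lra.
move=> /le_trans; apply.
rewrite -[leLHS]mul1r ler_pdivrMr//.
nra.
Qed.

Lemma expRN_nat_le (k : nat) : expR (- k%:R) <= 2%:R ^- k :> R.
Proof.
rewrite expRN lef_pV2 ?posrE ?expR_gt0 ?exprn_gt0//.
rewrite -[k%:R]mulr1 expRM_natl lerXn2r ?nnegrE ?expR_ge0//.
by have := expR_ge1Dx (1 : R); lra.
Qed.

Lemma sum_expRN_nat_le (M : nat) : \sum_(k < M) expR (- k%:R) <= 2 :> R.
Proof.
have : \sum_(k < M) expR (- k%:R) <= \sum_(k < M) 2%:R ^- k :> R.
  by apply: ler_sum => k _; exact: expRN_nat_le.
move=> /le_trans; apply.
suff -> : \sum_(k < M) 2%:R ^- k = 2 - 2 * 2%:R ^- M :> R.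
  by rewrite gerBl mulr_ge0// invr_ge0 exprn_ge0.
elim: M => [|M IH]; first by rewrite big_ord0 expr0 invr1 mulr1 subrr.
rewrite big_ord_recr/= IH exprS; field.
by rewrite expf_neq0.
Qed.

Lemma expR2_ge4 : 4 <= expR 2 :> R.
Proof.
have := expR_ge1Dx (1 : R); have -> : (2 : R) = 1 + 1 by [].
rewrite expRD; nra.
Qed.

End exponential.

(** * Random rounding to a grid *)

Section random_rounding.
Context {R : realType}.

Definition signed_val M (z : bool * 'I_M) : R := (-1) ^+ z.1 * z.2%:R.

(** Rounding to one of the two neighbouring integers, with the probabilities
    that make the rounding unbiased. *)
Lemma scalar_rounding M (a : R) : `|a| + 1 < M%:R ->
  exists rho : bool * 'I_M -> R,
  [/\ forall z, 0 <= rho z, \sum_z rho z = 1,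
      \sum_z rho z * (signed_val z - a) = 0,
      \sum_z rho z * (signed_val z - a) ^+ 2 <= 1 &
      \sum_z rho z * z.2%:R <= a ^+ 2 + 1].
Proof.
move=> aM; pose k := Num.truncn `|a|; pose f := `|a| - k%:R.
have /andP[ka ak] := truncn_itv (normr_ge0 a).
have f0 : 0 <= f by rewrite subr_ge0.
have f1 : f < 1 by rewrite ltrBlDl -[X in _ + X]/(1%:R) natr1.
have kM : (k.+1 < M)%N.
  by rewrite -(ltr_nat R) (le_lt_trans _ aM)// -natr1 lerD2r.
pose z0 : bool * 'I_M := (a < 0, Ordinal (ltnW kM)).
pose z1 : bool * 'I_M := (a < 0, Ordinal kM).
have aE : a = (-1) ^+ (a < 0)%R * (k%:R + f).
  by rewrite /f addrC subrK -numEsign.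
have z01 : z0 != z1 by rewrite xpair_eqE/= eqxx/= -val_eqE/= ltn_eqF.
pose rho z : R := if z == z0 then 1 - f else if z == z1 then f else 0.
have E F : \sum_z rho z * F z = (1 - f) * F z0 + f * F z1.
  rewrite (bigD1 z0)//= {1}/rho eqxx; congr (_ + _).
  rewrite (bigD1 z1) 1?eq_sym//= {1}/rho eq_sym (negbTE z01) eqxx.
  rewrite big1 ?addr0// => z /andP[/negbTE h0 /negbTE h1].
  by rewrite /rho h0 h1 mul0r.
have v0 : signed_val z0 - a = (-1) ^+ (a < 0)%R * - f.
  by rewrite [X in _ - X]aE /signed_val/=; ring.
have v1 : signed_val z1 - a = (-1) ^+ (a < 0)%R * (1 - f).
  by rewrite [X in _ - X]aE /signed_val/= -natr1; ring.
exists rho; split.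
- by move=> z; rewrite /rho; case: ifP => _; [lra|case: ifP].
- by have := E (fun=> 1); under eq_bigr do rewrite mulr1; move=> ->; ring.
- by rewrite E v0 v1; ring.
- by rewrite E v0 v1 !exprMn sqrr_sign !mul1r; nra.
- rewrite E /= -natr1.
  have -> : (1 - f) * k%:R + f * (k%:R + 1) = `|a| by rewrite /f; ring.
  by rewrite -(real_normK (num_real a)); have := sqr_ge0 (`|a| - 1); nra.
Qed.

Section product_weight.
Context {p : nat} {G : finType} (rho : 'I_p -> G -> R).
Hypothesis rho1 : forall j, \sum_k rho j k = 1.

Definition prod_weight (z : {ffun 'I_p -> G}) : R := \prod_j rho j (z j).

Lemma prod_weight_sum (F : 'I_p -> G -> R) :
  \sum_z prod_weight z * \prod_j F j (z j) = \prod_j \sum_k rho j k * F j k.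
Proof.
rewrite bigA_distr_bigA/=; apply: eq_bigr => z _.
by rewrite /prod_weight -big_split.
Qed.

Lemma prod_weight1 : \sum_z prod_weight z = 1.
Proof.
transitivity (\sum_z prod_weight z * \prod_j (fun _ _ => 1) j (z j)).
  by apply: eq_bigr => z _; rewrite big1// mulr1.
rewrite (prod_weight_sum (fun _ _ => 1)) big1// => j _.
by under eq_bigr do rewrite mulr1.
Qed.

Lemma prod_weight_marginal i (F : G -> R) :
  \sum_z prod_weight z * F (z i) = \sum_k rho i k * F k.
Proof.
have := prod_weight_sum (fun j k => if j == i then F k else 1).
rewrite (bigD1 i)//= eqxx [X in _ = _ * X]big1 ?mulr1 => [<-|j /negbTE ji].
  apply: eq_bigr => z _; rewrite (bigD1 i)//= eqxx big1 ?mulr1//.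
  by move=> j /negbTE ->.
by under eq_bigr do rewrite ji mulr1.
Qed.

Lemma prod_weight_marginal2 i i' (F F' : G -> R) : i != i' ->
  \sum_z prod_weight z * (F (z i) * F' (z i')) =
  (\sum_k rho i k * F k) * (\sum_k rho i' k * F' k).
Proof.
move=> ii'; have i'i : i' != i by rewrite eq_sym.
have := prod_weight_sum
  (fun j k => if j == i then F k else if j == i' then F' k else 1).
rewrite (bigD1 i)//= eqxx (bigD1 i')//= (negbTE i'i) eqxx.
rewrite [X in _ = _ * (_ * X)]big1 ?mulr1
  => [<-|j /andP[/negbTE ji /negbTE ji']].
  apply: eq_bigr => z _; rewrite (bigD1 i)//= eqxx (bigD1 i')//=.
  rewrite (negbTE i'i) eqxx big1 ?mulr1//.
  by move=> j /andP[/negbTE -> /negbTE ->].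
by under eq_bigr do rewrite ji ji' mulr1.
Qed.

(** The cross terms vanish because the coordinates are independent and
    centred. *)
Lemma prod_weight_variance (w : 'I_p -> R) (X : 'I_p -> G -> R) :
  (forall j, \sum_k rho j k * X j k = 0) ->
  \sum_z prod_weight z * (\sum_j w j * X j (z j)) ^+ 2 =
  \sum_j w j ^+ 2 * \sum_k rho j k * X j k ^+ 2.
Proof.
move=> X0.
transitivity (\sum_i \sum_j w i * w j *
    \sum_z prod_weight z * (X i (z i) * X j (z j))).
  transitivity (\sum_z \sum_i \sum_j
      w i * w j * (prod_weight z * (X i (z i) * X j (z j)))).
    apply: eq_bigr => z _; rewrite expr2 mulr_suml mulr_sumr.
    apply: eq_bigr => i _; rewrite !mulr_sumr; apply: eq_bigr => j _; ring.
  rewrite exchange_big/=; apply: eq_bigr => i _.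
  rewrite exchange_big/=; apply: eq_bigr => j _.
  by rewrite mulr_sumr.
apply: eq_bigr => i _; rewrite (bigD1 i)//= [X in _ + X]big1 ?addr0.
  rewrite -expr2; congr (_ * _).
  rewrite -(prod_weight_marginal i (fun k => X i k ^+ 2)).
  by apply: eq_bigr => z _; rewrite -expr2.
move=> j ji; rewrite eq_sym in ji.
by rewrite (prod_weight_marginal2 _ _ ji) X0 mul0r mulr0.
Qed.

End product_weight.

Section grid.
Context {p M : nat}.
Local Notation grid := {ffun 'I_p -> bool * 'I_M}.

Definition grid_cost (z : grid) : R := \sum_j (2 + (z j).2%:R).

(** Zero has two representatives in [bool * 'I_M]; this only lowers the weight
    available to the other points. *)
Definition grid_point (dl : R) (z : grid) : 'cV[R]_p :=
  \col_j (dl * signed_val (z j)).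

(** The weights are a product of two-sided geometric laws, and the constant
    cost [2] per coordinate pays for the normalisation: [expR 2 >= 4]. *)
Lemma sum_expRN_grid_cost : \sum_z expR (- grid_cost z) <= 1.
Proof.
have -> : \sum_z expR (- grid_cost z) =
    \sum_(z : grid) \prod_j expR (- (2 + (z j).2%:R)).
  by apply: eq_bigr => z _; rewrite /grid_cost -sumrN expR_sum.
rewrite -(bigA_distr_bigA
  (fun (j : 'I_p) (k : bool * 'I_M) => expR (- (2 + k.2%:R)) : R))/=.
apply: prodr_ile1 => j _.
rewrite sumr_ge0/=; last by move=> z _; exact: expR_ge0.
rewrite -(pair_bigA _ (fun (b : bool) (k : 'I_M) => expR (- (2 + k%:R))))/=.
rewrite big_bool/=.
have -> : \sum_(k < M) expR (- (2 + k%:R)) =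
    expR (- 2) * \sum_(k < M) expR (- k%:R) :> R.
  by rewrite mulr_sumr; apply: eq_bigr => k _; rewrite opprD expRD.
rewrite expRN -mulrDr mulrC ler_pdivrMr ?expR_gt0// mul1r.
apply: le_trans expR2_ge4; have := sum_expRN_nat_le (R := R) M; lra.
Qed.

(** The error has variance at most [dl ^+ 2] in each coordinate.  The cost of a
    coordinate is linear in its integer value, hence at most quadratic, and
    the squares of the coordinates of [u] add up to one. *)
Lemma unit_vector_rounding (dl : R) (u : 'cV[R]_p) : 0 < dl ->
  dl^-1 + 1 < M%:R -> dot u u = 1 ->
  exists rho : grid -> R,
  [/\ forall z, 0 <= rho z, \sum_z rho z = 1,
      forall w : 'cV[R]_p,
        \sum_z rho z * (dot w (grid_point dl z) - dot w u) ^+ 2 <=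
          dl ^+ 2 * dot w w &
      \sum_z rho z * grid_cost z <= 3 * p%:R + dl ^- 2].
Proof.
move=> dl0 dlM u1.
have uj j : `|u j 0| <= 1.
  rewrite -(ler_pXn2r (n := 2))// ?nnegrE// expr1n real_normK ?num_real// -u1.
  rewrite /dot (bigD1 j)//= -expr2 lerDl sumr_ge0// => i _.
  by rewrite -expr2 sqr_ge0.
have aM j : `|u j 0 / dl| + 1 < M%:R.
  apply: le_lt_trans dlM; rewrite lerD2r normrM [`|dl^-1|]gtr0_norm ?invr_gt0//.
  by rewrite ler_piMl// invr_ge0 ltW.
have /choice[r rP] j := scalar_rounding (aM j).
have r1 j : \sum_k r j k = 1 by have [] := rP j.
exists (prod_weight r); split.
- by move=> z; apply: prodr_ge0 => j _; have [] := rP j.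
- exact: prod_weight1.
- move=> w.
  have -> : \sum_z prod_weight r z * (dot w (grid_point dl z) - dot w u) ^+ 2 =
      \sum_z prod_weight r z *
        (\sum_j (dl * w j 0) * (signed_val (z j) - u j 0 / dl)) ^+ 2.
    apply: eq_bigr => z _; congr (_ * _ ^+ 2); rewrite /dot -sumrB.
    by apply: eq_bigr => j _; rewrite mxE; field; rewrite gt_eqF.
  rewrite (prod_weight_variance r1 (fun j => dl * w j 0)
    (X := fun j k => signed_val k - u j 0 / dl)) => [|j]; last first.
    by have [] := rP j.
  rewrite /dot mulr_sumr; apply: ler_sum => j _.
  rewrite exprMn -[X in _ <= dl ^+ 2 * X]expr2 ler_piMr//.
    by rewrite mulr_ge0// sqr_ge0.
  by have [] := rP j.
- have -> : \sum_z prod_weight r z * grid_cost z =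
      \sum_j (2 + \sum_k r j k * k.2%:R).
    under eq_bigr do rewrite /grid_cost mulr_sumr.
    rewrite exchange_big/=; apply: eq_bigr => j _.
    rewrite (prod_weight_marginal r1 j (fun k => 2 + k.2%:R)).
    rewrite -[X in X + _]mul1r -(r1 j) mulr_suml -big_split/=.
    by apply: eq_bigr => k _; rewrite mulrDr.
  apply: (@le_trans _ _ (\sum_(j < p) (3 + u j 0 * u j 0 * dl ^- 2))).
    apply: ler_sum => j _; have [_ _ _ _ h] := rP j.
    by have := h; rewrite exprMn exprVn expr2; lra.
  rewrite big_split/= -mulr_suml -/(dot u u) u1 mul1r sumr_const card_ord.
  by rewrite mulr_natr.
Qed.

End grid.
End random_rounding.

(** * A uniform exponential bound *)

Section uniform_exponential.
Context {d d' : measure_display} {T : measurableType d}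
  {S : measurableType d'} {R : realType} (P : probability T R).

Lemma markov_ge0 (V : T -> R) (c : R) : measurable_fun setT V ->
  (forall w, 0 <= V w) -> 0 < c -> (\int[P]_w (V w)%:E <= 1)%E ->
  (P [set w | (c <= V w)%R] <= (c^-1)%:E)%E.
Proof.
move=> mV V0 c0 V1; set B := mkset _.
have mB : measurable B.
  by rewrite -[B]setTI; apply: measurable_fun_le.
have mVE D : measurable_fun D (fun w => (V w)%:E).
  by apply/measurable_EFinP; exact: measurable_funS mV.
rewrite -[leRHS]mule1 lee_pdivlMl//.
apply: le_trans V1; rewrite -integral_cst//.
apply: (@le_trans _ _ (\int[P]_(w in B) (V w)%:E)%E).
  apply: ge0_le_integral => //.
  by move=> w _; rewrite lee_fin ltW.
by apply: ge0_subset_integral => // w _; rewrite lee_fin.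
Qed.

(** A union bound in which each index pays its own cost: the exponentials of
    all the centred sums are averaged with the weights [expR (- L i)], and
    Markov's inequality is applied once to the average. *)
Lemma uniform_exponential_bound (I : finType) n (Z : 'I_n -> T -> S)
    (Z0 : T -> S) (Y : I -> S -> R) (m L : I -> R) (t : R) :
  iid_copies P Z Z0 -> (forall k, measurable_fun setT (Z k)) ->
  measurable_fun setT Z0 -> (forall i, measurable_fun setT (Y i)) ->
  (forall i, (\int[P]_w (expR (Y i (Z0 w)))%:E <= (expR (m i))%:E)%E) ->
  \sum_i expR (- L i) <= 1 ->
  let A := [set w | forall i, \sum_k Y i (Z k w) <= n%:R * m i + t + L i] in
  measurable A /\ ((1 - expR (- t))%:E <= P A)%E.
Proof.
move=> iid mZ mZ0 mY Ym L1 A.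
have mYZ i k : measurable_fun setT (fun w => Y i (Z k w)).
  exact: (measurableT_comp (mY i) (mZ k)).
have mA : measurable A.
  rewrite (_ : A = \bigcap_(i in [set: I])
      [set w | \sum_k Y i (Z k w) <= n%:R * m i + t + L i]); last first.
    by apply/seteqP; split=> w /= h i; [move=> _; exact: h|exact: h].
  apply: fin_bigcap_measurable => // i _; rewrite -[X in measurable X]setTI.
  by apply: measurable_fun_le => //; apply: measurable_sum => k; exact: mYZ.
split => //.
pose E i w := \prod_(k < n) expR (Y i (Z k w)).
have mE i : measurable_fun setT (E i).
  apply: measurable_prod => k _; 
  by apply: measurableT_comp; [exact: measurable_expR|exact: mYZ].
have E0 i w : 0 <= E i w by apply: prodr_ge0 => k _; exact: expR_ge0.
pose V w := \sum_i expR (- L i - n%:R * m i) * E i w.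
have mV : measurable_fun setT V.
  by apply: measurable_sum => i; apply: measurable_funM.
have V0 w : 0 <= V w by apply: sumr_ge0 => i _; rewrite mulr_ge0// expR_ge0.
have V1 : (\int[P]_w (V w)%:E <= 1)%E.
  rewrite (_ : (fun w => (V w)%:E) = (fun w =>
      \sum_i (expR (- L i - n%:R * m i))%:E * (E i w)%:E)%E); last first.
    apply/funext => w; rewrite /V -sumEFin.
    by apply: eq_bigr => i _; rewrite EFinM.
  rewrite ge0_integral_sum//; last 2 first.
  - move=> i; apply: emeasurable_funM => //; exact/measurable_EFinP.
  - by move=> i w _; rewrite -EFinM lee_fin mulr_ge0// expR_ge0.
  rewrite -[1%E]/(1%:E) (le_trans _ (_ : (\sum_i expR (- L i))%:E <= 1%:E)%E)//.
  rewrite -sumEFin; apply: lee_sum => i _.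
  rewrite ge0_integralZl//; last 2 first.
  - exact/measurable_EFinP.
  - by move=> w _; rewrite lee_fin.
  rewrite expRD EFinM -muleA -[leRHS]mule1 lee_wpmul2l ?lee_fin ?expR_ge0//.
  rewrite expRN lee_pdivrMl ?expR_gt0// mule1 expRM_natl.
  apply: (@iid_integral_prod_le _ _ _ _ _ P n Z Z0 (expR \o Y i)) => //.
  - by apply: measurableT_comp; [exact: measurable_expR|exact: mY].
  - by move=> s; exact: expR_ge0.
  - exact: Ym.
have mB : measurable [set w | expR t <= V w].
  by rewrite -[X in measurable X]setTI; apply: measurable_fun_le.
have AB : ~` A `<=` [set w | expR t <= V w].
  move=> w /existsNP[i /negP]; rewrite -ltNge => iY /=.
  rewrite /V (bigD1 i)//= -[leLHS]addr0 lerD//; last first.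
    by apply: sumr_ge0 => j _; rewrite mulr_ge0// expR_ge0.
  by rewrite /E -expR_sum -expRD ler_expR; lra.
have PA : (P (~` A) <= (expR (- t))%:E)%E.
  apply: le_trans (le_measure P _ _ AB) _; rewrite ?inE//.
    exact: measurableC.
  by rewrite expRN; apply: markov_ge0 => //; exact: expR_gt0.
rewrite -[A]setCK probability_setC; last exact: measurableC.
by rewrite EFinB leeB.
Qed.

End uniform_exponential.

(** * Inner products and measurability *)

Section dot_product.
Context {R : realType} {p : nat}.
Implicit Types (u v w : 'cV[R]_p) (a : R).

Lemma dotC u v : dot u v = dot v u.
Proof. by apply: eq_bigr => j _; rewrite mulrC. Qed.

Lemma dotZr a u v : dot u (a *: v) = a * dot u v.
Proof.
by rewrite /dot mulr_sumr; apply: eq_bigr => j _; rewrite mxE mulrCA.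
Qed.

Lemma dotZl a u v : dot (a *: u) v = a * dot u v.
Proof. by rewrite dotC dotZr dotC. Qed.

Lemma dotDr u v w : dot u (v + w) = dot u v + dot u w.
Proof.
by rewrite /dot -big_split; apply: eq_bigr => j _; rewrite mxE mulrDr.
Qed.

Lemma dot_suml n (F : 'I_n -> 'cV[R]_p) u :
  dot (\sum_i F i) u = \sum_i dot (F i) u.
Proof.
rewrite /dot exchange_big/=; apply: eq_bigr => j _.
by rewrite summxE mulr_suml.
Qed.

Lemma dot_ge0 u : 0 <= dot u u.
Proof. by apply: sumr_ge0 => j _; rewrite -expr2 sqr_ge0. Qed.

Lemma dot_gt0 u : u != 0 -> 0 < dot u u.
Proof.
rewrite lt0r dot_ge0 andbT; apply: contra_neq => u0.
apply/colP => j; rewrite mxE; apply/eqP; rewrite -sqrf_eq0 expr2.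
move/eqP: u0; rewrite psumr_eq0 => [/allP/(_ j)|i _]; last first.
  by rewrite -expr2 sqr_ge0.
by rewrite mem_index_enum => /(_ isT).
Qed.

Lemma dot_mulmxr (A : 'M[R]_p) u v : dot u (A *m v) = dot (A^T *m u) v.
Proof.
rewrite /dot; under eq_bigr do rewrite mxE mulr_sumr.
rewrite exchange_big/=; apply: eq_bigr => j _.
rewrite mxE mulr_suml; apply: eq_bigr => i _.
by rewrite mxE; ring.
Qed.

Lemma norm2_eq1 u : norm2 u = 1 <-> dot u u = 1.
Proof.
rewrite /norm2; split => [u1|->]; last exact: sqrtr1.
by rewrite -(sqr_sqrtr (dot_ge0 u)) u1 expr1n.
Qed.

Lemma measurable_dot d (S : measurableType d) (W : S -> 'cV[R]_p) u :
  (forall j, measurable_fun setT (fun s => W s j 0)) ->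
  measurable_fun setT (fun s => dot u (W s)).
Proof.
by move=> mW; apply: measurable_sum => j; apply: measurable_funM.
Qed.

Lemma measurable_dot_diag d (S : measurableType d) (W : S -> 'cV[R]_p) :
  (forall j, measurable_fun setT (fun s => W s j 0)) ->
  measurable_fun setT (fun s => dot (W s) (W s)).
Proof.
by move=> mW; apply: measurable_sum => j; apply: measurable_funM.
Qed.

End dot_product.

Section measurable_integrable.
Context {d : measure_display} {T : measurableType d} {R : realType}.

Lemma measurable_truncsq (a : R) (f : T -> R) : measurable_fun setT f ->
  measurable_fun setT (fun w => truncsq a (f w)).
Proof.
move=> mf; apply: measurable_fun_if => //.
- by apply: measurable_fun_ler => //; exact: measurableT_comp.
- by apply: measurable_funTS; exact: measurable_funX.
Qed.

Context (P : probability T R).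

Lemma le_integrable_EFin (f g : T -> R) : measurable_fun setT f ->
  (forall w, 0 <= f w <= g w) -> P.-integrable setT (EFin \o g) ->
  P.-integrable setT (EFin \o f).
Proof.
move=> mf fg; apply: le_integrable => //; first exact/measurable_EFinP.
move=> w _; have /andP[f0 fgw] := fg w.
by rewrite /= lee_fin !ger0_norm// (le_trans f0).
Qed.

Lemma bounded_integrable_EFin (f : T -> R) (M : R) : measurable_fun setT f ->
  (forall w, 0 <= f w <= M) -> P.-integrable setT (EFin \o f).
Proof.
move=> mf fM; apply: (@le_integrable_EFin _ (cst M)) => //.
exact: finite_measure_integrable_cst.
Qed.

End measurable_integrable.

(** * The uniform lower tail *)

Section lower_tail.
Context {d d' : measure_display} {T : measurableType d}
  {S : measurableType d'} {R : realType} (P : probability T R).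

(** The core estimate.  A single exponential inequality is used for every
    point of a grid, with the error of the rounding inside the exponent; the
    point [u] is then reached by averaging over its random rounding. *)
Lemma truncsq_sum_lower_tail (p n : nat) (Z : 'I_n -> T -> S) (Z0 : T -> S)
    (chi : S -> R) (W : S -> 'cV[R]_p) (ql qu m c dl t : R) :
  iid_copies P Z Z0 -> (forall k, measurable_fun setT (Z k)) ->
  measurable_fun setT Z0 -> measurable_fun setT chi ->
  (forall s, chi s = 0 \/ chi s = 1) ->
  (forall j, measurable_fun setT (fun s => W s j 0)) ->
  0 < m -> 0 <= c -> c <= 5 / 4 * m -> 0 < dl ->
  P.-integrable setT (fun w => (dot (W (Z0 w)) (W (Z0 w)))%:E) ->
  \int[P]_w (chi (Z0 w) * dot (W (Z0 w)) (W (Z0 w))) <= qu ->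
  (forall u : 'cV[R]_p, dot u u = 1 ->
    ql <= \int[P]_w (chi (Z0 w) * truncsq c (dot u (W (Z0 w))))) ->
  exists A : set T, [/\ measurable A, ((1 - expR (- t))%:E <= P A)%E &
    forall w u, A w -> dot u u = 1 ->
      n%:R * (199 / 201 * ql - 601 * dl ^+ 2 * qu)
        - 600 * m ^+ 2 * (t + 3 * p%:R + dl ^- 2) <=
      201 / 200 * \sum_k chi (Z k w) * truncsq (2 * m) (dot u (W (Z k w)))].
Proof.
move=> iid mZ mZ0 mchi chi01 mW m0 c0 cm dl0 iW Hqu Hql.
have [C CE] : exists C : R, C = 201 by eexists.
have C0 : 0 <= C by lra.
(* [C = 1 + 1 / eta] with [eta = 1 / 200]; the level [a] lies between [c] and
   [2 * m], at distance at least [m / 4] from both, and [lam * a ^+ 2] is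
   small enough for [expR_sub_le]. *)
pose a := 3 / 2 * m.
have a0 : 0 <= a by rewrite /a; lra.
have m2 : 0 < m ^+ 2 by rewrite exprn_gt0.
have [lam lam0 lamE] : exists2 lam : R, 0 < lam & lam * (600 * m ^+ 2) = 1.
  have m0' : 0 < 600 * m ^+ 2 by lra.
  exists (600 * m ^+ 2)^-1; first by rewrite invr_gt0.
  exact: (mulVf (lt0r_neq0 m0')).
pose M := (Num.truncn (dl^-1 + 1)).+1.
have dlM : dl^-1 + 1 < M%:R by exact: truncnS_gt.
pose psi (z : {ffun 'I_p -> bool * 'I_M}) s :=
  truncsq a (dot (W s) (grid_point dl z)).
pose b s := Num.min (C * (dl ^+ 2 * dot (W s) (W s))) (a ^+ 2).
have psi0 z s : 0 <= psi z s by exact: truncsq_ge0.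
have psia z s : psi z s <= a ^+ 2 by exact: truncsq_le.
have b0 s : 0 <= b s.
  by rewrite le_min sqr_ge0 andbT mulr_ge0// mulr_ge0 ?sqr_ge0// dot_ge0.
have ba s : b s <= a ^+ 2 by rewrite ge_min lexx orbT.
have bW s : b s <= C * dl ^+ 2 * dot (W s) (W s).
  by rewrite ge_min mulrA lexx.
have chi0 s : 0 <= chi s by case: (chi01 s) => ->.
have chi1 s : chi s <= 1 by case: (chi01 s) => ->.
have mpsi z : measurable_fun setT (psi z).
  apply: measurable_truncsq; under eq_fun do rewrite dotC.
  exact: measurable_dot.
have mb : measurable_fun setT b.
  apply: measurable_minr => //; do 2 apply: measurable_funM => //.
  exact: measurable_dot_diag.
have mchiZ (f : S -> R) : measurable_fun setT f ->
    measurable_fun setT (fun w => chi (Z0 w) * f (Z0 w)).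
  by move=> mf; apply: measurable_funM; exact: measurableT_comp.
have ichi (f : S -> R) (e : R) :
    measurable_fun setT f -> (forall s, 0 <= f s <= e) ->
    P.-integrable setT (fun w => (chi (Z0 w) * f (Z0 w))%:E).
  move=> mf f01; apply: (@bounded_integrable_EFin _ _ _ _ _ e).
    exact: mchiZ.
  move=> w; have /andP[f0 f1] := f01 (Z0 w).
  by rewrite mulr_ge0//= (le_trans _ f1)// ler_piMl.
have ipsi z : P.-integrable setT (fun w => (chi (Z0 w) * psi z (Z0 w))%:E).
  by apply: (ichi _ (a ^+ 2)) => // s; rewrite psi0 psia.
have ib : P.-integrable setT (fun w => (chi (Z0 w) * b (Z0 w))%:E).
  by apply: (ichi _ (a ^+ 2)) => // s; rewrite b0 ba.
have iWW : P.-integrable setT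
    (fun w => (chi (Z0 w) * dot (W (Z0 w)) (W (Z0 w)))%:E).
  apply: le_integrable_EFin iW.
    by apply: (mchiZ (fun s => dot (W s) (W s))); exact: measurable_dot_diag.
  by move=> w; rewrite mulr_ge0 ?dot_ge0//= ler_piMl// dot_ge0.
pose ez z := \int[P]_w (chi (Z0 w) * psi z (Z0 w)).
pose eb := \int[P]_w (chi (Z0 w) * b (Z0 w)).
have ebqu : eb <= C * dl ^+ 2 * qu.
  apply: (@le_trans _ _ (C * dl ^+ 2 *
      \int[P]_w (chi (Z0 w) * dot (W (Z0 w)) (W (Z0 w))))); last first.
    by rewrite ler_wpM2l// mulr_ge0// sqr_ge0.
  rewrite -RintegralZl//; apply: le_Rintegral => //.
    exact: (integrableZl measurableT (C * dl ^+ 2) iWW).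
  by move=> w _; rewrite mulrCA ler_wpM2l.
pose Y z s := chi s * (lam * (b s - psi z s)).
pose mz z := 2 * lam * eb - 199 / 200 * lam * ez z.
have mY z : measurable_fun setT (Y z).
  apply: measurable_funM => //; apply: measurable_funM => //.
  exact: measurable_funB.
have la : lam * a ^+ 2 <= 1 / 250.
  have -> : a ^+ 2 = (600 * m ^+ 2) * (9 / 2400) by rewrite /a; field.
  by rewrite mulrA lamE; lra.
have expY z s : expR (Y z s) <=
    1 + (2 * lam * (chi s * b s) - 199 / 200 * lam * (chi s * psi z s)).
  rewrite /Y; case: (chi01 s) => ->.
    by rewrite !mul0r !mulr0 subrr addr0 expR0.
  rewrite !mul1r mulrBr.
  have h1 : 0 <= lam * psi z s <= 1 / 250.
    rewrite mulr_ge0 ?(ltW lam0)//=; apply: le_trans la.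
    by rewrite ler_wpM2l// ltW.
  have h2 : 0 <= lam * b s <= 1 / 250.
    rewrite mulr_ge0 ?(ltW lam0)//=; apply: le_trans la.
    by rewrite ler_wpM2l// ltW.
  by have := expR_sub_le h1 h2; clear -P S; lra.
have iZb : P.-integrable setT (fun w => (2 * lam * (chi (Z0 w) * b (Z0 w)))%:E).
  exact: (integrableZl measurableT (2 * lam) ib).
have iZpsi z : P.-integrable setT
    (fun w => (199 / 200 * lam * (chi (Z0 w) * psi z (Z0 w)))%:E).
  exact: (integrableZl measurableT (199 / 200 * lam) (ipsi z)).
have Ymz z : (\int[P]_w (expR (Y z (Z0 w)))%:E <= (expR (mz z))%:E)%E.
  apply: (@le_trans _ _ (\int[P]_w (1 + (2 * lam * (chi (Z0 w) * b (Z0 w))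
      - 199 / 200 * lam * (chi (Z0 w) * psi z (Z0 w))))%:E)%E).
    apply: ge0_le_integral => //.
    - apply/measurable_EFinP; apply: measurableT_comp.
        exact: measurable_expR.
      exact: (measurableT_comp (mY z) mZ0).
    - apply/measurable_EFinP; apply: measurable_funD => //.
      by apply: measurable_funB; apply: measurable_funM => //; exact: mchiZ.
    - by move=> w _; rewrite lee_fin.
  have i1 : P.-integrable setT (EFin \o cst (1 : R)).
    exact: finite_measure_integrable_cst.
  have iB := integrableB measurableT iZb (iZpsi z).
  rewrite -[leLHS]fineK; last first.
    by apply: integrable_fin_num => //; exact: (integrableD measurableT i1 iB).
  rewrite lee_fin -[fine _]/(Rintegral P setT (fun w => _)).
  have iZpsiz := iZpsi z; rewrite RintegralD// RintegralB//=.
  have -> : \int[P]_w (2 * lam * (chi (Z0 w) * b (Z0 w))) = 2 * lam * eb.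
    exact: RintegralZl.
  have -> : \int[P]_w (199 / 200 * lam * (chi (Z0 w) * psi z (Z0 w))) =
      199 / 200 * lam * ez z.
    exact: (RintegralZl (199 / 200 * lam) measurableT (ipsi z)).
  have -> : \int[P]_w 1 = 1 :> R.
    transitivity (1 * fine (P [set: T])).
      exact: (Rintegral_cst P measurableT).
    by rewrite probability_setT mulr1.
  exact: expR_ge1Dx.
have [mA PA] := uniform_exponential_bound t iid mZ mZ0 mY Ymz
  (sum_expRN_grid_cost (R := R) (p := p) (M := M)).
eexists; split; [exact: mA|exact: PA|].
move=> w u /= Aw u1.
have [rho [rho0 rho1 rhov rhoc]] := unit_vector_rounding dl0 dlM u1.
have rounding_err s :
    C * \sum_z rho z * (dot (W s) (grid_point dl z) - dot (W s) u) ^+ 2 <=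
    C * (dl ^+ 2 * dot (W s) (W s)) by rewrite ler_wpM2l.
have eta0 : 0 < 1 / 200 :> R by clear -P S; lra.
have etaC : 1 + (1 / 200)^-1 <= C by rewrite div1r invrK CE; clear -P S; lra.
have psi_le s : \sum_z rho z * psi z s <=
    201 / 200 * truncsq (2 * m) (dot u (W s)) + b s.
  have h1 : a <= 2 * m by rewrite /a; clear -P S m0; lra.
  have h2 : a ^+ 2 <= C * (2 * m - a) ^+ 2 by rewrite /a CE; clear -P S m2; nra.
  have := truncsq_average_le (fun z => dot (W s) (grid_point dl z))
    rho0 rho1 (dot (W s) u) eta0 a0 h1 etaC h2.
  move=> /le_trans; apply.
  rewrite (dotC u) lerD//.
    by rewrite ler_wpM2r ?truncsq_ge0//; clear -P S; lra.
  by rewrite le_min !ge_min lexx rounding_err orbT.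
have trunc_le s : truncsq c (dot u (W s)) <=
    201 / 200 * (\sum_z rho z * psi z s) + C * dl ^+ 2 * dot (W s) (W s).
  have h1 : c <= a by rewrite /a; clear -P S m0 cm; lra.
  have h2 : c ^+ 2 <= C * (a - c) ^+ 2.
    by rewrite /a CE; clear -P S m0 c0 cm; nra.
  have := truncsq_le_average (fun z => dot (W s) (grid_point dl z))
    rho0 rho1 (dot (W s) u) eta0 c0 h1 etaC h2.
  rewrite (dotC u) => /le_trans; apply.
  have S0 : 0 <= \sum_z rho z * psi z s.
    by apply: sumr_ge0 => z _; rewrite mulr_ge0.
  rewrite -(mulrA C) lerD// ler_wpM2r//; clear -P S; lra.
(* The mean at [u] is recovered from the means at the grid points. *)
pose A0 := \sum_z rho z * ez z.
have qlA : ql <= 201 / 200 * A0 + C * dl ^+ 2 * qu.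
  apply: (le_trans (Hql u u1)).
  have icpsi z : P.-integrable setT
      (fun w => (rho z * (chi (Z0 w) * psi z (Z0 w)))%:E).
    exact: (integrableZl measurableT (rho z) (ipsi z)).
  have isum : P.-integrable setT
      (fun w => (\sum_z rho z * (chi (Z0 w) * psi z (Z0 w)))%:E).
    under eq_fun do rewrite -sumEFin.
    exact: (integrable_sum measurableT _ (fun z _ => icpsi z)).
  have iI := integrableZl measurableT (201 / 200) isum.
  have iII := integrableZl measurableT (C * dl ^+ 2) iWW.
  apply: (@le_trans _ _ (\int[P]_w (201 / 200 *
        (\sum_z rho z * (chi (Z0 w) * psi z (Z0 w))) +
      C * dl ^+ 2 * (chi (Z0 w) * dot (W (Z0 w)) (W (Z0 w)))))).
    apply: le_Rintegral => //.
    - apply: (ichi (fun s => truncsq c (dot u (W s))) (c ^+ 2)).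
        by apply: measurable_truncsq; exact: measurable_dot.
      by move=> s; rewrite truncsq_ge0 truncsq_le.
    - exact: (integrableD measurableT iI iII).
    move=> v _.
    rewrite (le_trans (ler_wpM2l (chi0 (Z0 v)) (trunc_le (Z0 v))))//.
    rewrite mulrDr mulrCA (mulrCA _ (C * _)) mulr_sumr.
    by under eq_bigr do rewrite mulrCA.
  rewrite RintegralD//= !RintegralZl//=.
  rewrite lerD//; last by rewrite ler_wpM2l// mulr_ge0// sqr_ge0.
  have r1 : 0 <= 201 / 200 :> R by clear -P S; lra.
  rewrite ler_wpM2l//.
  rewrite le_eqVlt; apply/orP; left; apply/eqP.
  rewrite /Rintegral; under eq_integral do rewrite -sumEFin.
  rewrite integral_sum// -sum_fine; last first.
    by move=> z _; exact: integrable_fin_num.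
  apply: eq_bigr => z _.
  exact: (RintegralZl (rho z) measurableT (ipsi z)).
pose X := \sum_k chi (Z k w) * truncsq (2 * m) (dot u (W (Z k w))).
have XA : - lam * (201 / 200 * X) <=
    n%:R * (2 * lam * eb - 199 / 200 * lam * A0) + t + (3 * p%:R + dl ^- 2).
  apply: (@le_trans _ _ (\sum_z rho z * \sum_k Y z (Z k w))).
    have -> : \sum_z rho z * \sum_k Y z (Z k w) =
        \sum_k \sum_z rho z * Y z (Z k w).
      by under eq_bigr do rewrite mulr_sumr; rewrite exchange_big.
    rewrite mulr_sumr mulr_sumr; apply: ler_sum => k _.
    have -> : \sum_z rho z * Y z (Z k w) =
        chi (Z k w) * lam * (b (Z k w) - \sum_z rho z * psi z (Z k w)).
      rewrite -[b _]mul1r -rho1 mulr_suml -sumrB mulr_sumr.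
      by apply: eq_bigr => z _; rewrite /Y; ring.
    have -> : - lam * (201 / 200 * (chi (Z k w) *
          truncsq (2 * m) (dot u (W (Z k w))))) =
        chi (Z k w) * lam *
          - (201 / 200 * truncsq (2 * m) (dot u (W (Z k w)))) by ring.
    rewrite ler_wpM2l//; first by rewrite mulr_ge0// ltW.
    by have := psi_le (Z k w); clear -P S; lra.
  apply: (@le_trans _ _ (\sum_z rho z * (n%:R * mz z + t + grid_cost z))).
    by apply: ler_sum => z _; rewrite ler_wpM2l.
  have -> : \sum_z rho z * (n%:R * mz z + t + grid_cost z) =
      n%:R * (2 * lam * eb - 199 / 200 * lam * A0) + t +
        \sum_z rho z * grid_cost z.
    transitivity (\sum_z (rho z * (n%:R * (2 * lam * eb) + t) -
        n%:R * (199 / 200 * lam) * (rho z * ez z) + rho z * grid_cost z)).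
      by apply: eq_bigr => z _; rewrite /mz; ring.
    rewrite big_split/= sumrB -mulr_suml rho1 -mulr_sumr -/A0; ring.
  by rewrite lerD2l.
rewrite -/X.
have n0 : 0 <= n%:R :> R by [].
have KX : 0 <= 600 * m ^+ 2 by clear -P S m2; lra.
have := ler_wpM2l KX XA.
have -> : 600 * m ^+ 2 * (- lam * (201 / 200 * X)) =
  - (lam * (600 * m ^+ 2)) * (201 / 200 * X) by ring.
have -> : 600 * m ^+ 2 * (n%:R * (2 * lam * eb - 199 / 200 * lam * A0) + t +
    (3 * p%:R + dl ^- 2)) =
  (lam * (600 * m ^+ 2)) * n%:R * (2 * eb - 199 / 200 * A0) +
    600 * m ^+ 2 * (t + 3 * p%:R + dl ^- 2) by ring.
rewrite lamE CE in ebqu qlA *.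
set D := 600 * m ^+ 2 * (t + 3 * p%:R + dl ^- 2).
move=> XA'.
have h : 199 / 201 * ql - 601 * dl ^+ 2 * qu <= 199 / 200 * A0 - 2 * eb.
  by clear -P S ebqu qlA; lra.
by have := ler_wpM2l n0 h; clear -P S XA'; lra.
Qed.

End lower_tail.

(** * The residual given the design *)

Section conditional_density.
Context {d d' : measure_display} {T : measurableType d}
  {S : measurableType d'} {R : realType} (P : probability T R).
Local Notation leb := (@lebesgue_measure R).

Lemma lebesgue_symm_itv (a : R) : 0 < a ->
  leb [set` `[- a, a]] = (2 * a)%:E.
Proof.
move=> a0; rewrite lebesgue_measure_itv/= lte_fin ifT; last by lra.
by congr EFin; ring.
Qed.

Lemma lipschitz_density_upper (g : R -> R) (fup flow l0 h : R) :
  measurable_fun setT g -> (forall u, 0 <= g u) -> 0 < flow -> 0 < l0 ->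
  0 < h -> l0 * h <= flow / 4 -> flow <= g 0 <= fup ->
  (forall u v : R, `|g u - g v| <= l0 * `|u - v|) ->
  (\int[leb]_(u in [set` `[(- (h / 2))%R, (h / 2)%R]]) (g u)%:E <=
   (9 / 8 * fup * h)%:E)%E.
Proof.
move=> mg g0 flow0 l00 h0 hl /andP[gf1 gf2] glip.
have h2 : 0 < h / 2 by lra.
have -> : 9 / 8 * fup * h = 9 / 8 * fup * (2 * (h / 2)) by field.
rewrite EFinM -lebesgue_symm_itv// -integral_cst//.
apply: ge0_le_integral => //.
- by move=> u _; rewrite lee_fin.
- by apply/measurable_EFinP; exact: measurable_funTS.
move=> u; rewrite /= in_itv/= -ler_norml => u2; rewrite lee_fin/=.
have := glip u 0; rewrite subr0 ler_norml => /andP[_ gu].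
have := ler_wpM2l (ltW l00) u2; lra.
Qed.

(** On the middle half of the interval the Lipschitz bound costs half as much
    as at the ends, which leaves room above [7 / 8 * flow * h]. *)
Lemma lipschitz_density_lower (g : R -> R) (fup flow l0 h : R) :
  measurable_fun setT g -> (forall u, 0 <= g u) -> 0 < flow -> 0 < l0 ->
  0 < h -> l0 * h <= flow / 4 -> flow <= g 0 <= fup ->
  (forall u v : R, `|g u - g v| <= l0 * `|u - v|) ->
  ((29 / 32 * flow * h)%:E <=
   \int[leb]_(u in [set` `[(- (h / 2))%R, (h / 2)%R]]) (g u)%:E)%E.
Proof.
move=> mg g0 flow0 l00 h0 hl /andP[gf1 gf2] glip.
pose I (a : R) : set R := [set` `[- a, a]].
have in_I a u : I a u <-> `|u| <= a by rewrite /I /= in_itv/= ler_norml.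
have gdev (u e : R) : `|u| <= e -> g 0 - l0 * e <= g u.
  move=> ue; have := glip u 0; rewrite subr0 ler_norml => /andP[gu _].
  by have := ler_wpM2l (ltW l00) ue; lra.
have h2 : 0 < h / 2 by lra.
have h4 : 0 < h / 4 by lra.
have -> : 29 / 32 * flow * h =
    7 / 8 * flow * (2 * (h / 2)) + 1 / 16 * flow * (2 * (h / 4)) by field.
have mI a : measurable (I a) by exact: measurable_itv.
have II : I (h / 2) `&` I (h / 4) = I (h / 4).
  by apply/setIidPr => u /in_I u4; apply/in_I; lra.
have f8 : 0 <= 7 / 8 * flow by lra.
have f16 : 0 <= 1 / 16 * flow by lra.
have m4 D : measurable_fun D (fun u : R => (\1_(I (h / 4)) u)%:E : \bar R).
  exact/measurable_EFinP/measurable_funTS/measurable_indic.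
rewrite EFinD (EFinM (7 / 8 * flow)) (EFinM (1 / 16 * flow)).
rewrite -!lebesgue_symm_itv// -integral_cst//.
rewrite -/(I (h / 2)).
have -> : leb (I (h / 4)) =
    (\int[leb]_(u in I (h / 2)%R) (\1_(I (h / 4)%R) u)%:E)%E.
  rewrite integral_indic; first by rewrite setIC II.
  - exact: measurable_itv.
  - exact: measurable_itv.
have mI2 : (measurable : set (set (measurableTypeR R))) (I (h / 2)).
  exact: measurable_itv.
rewrite -ge0_integralZl//; last exact: m4.
rewrite -ge0_integralD//; last 2 first.
- by move=> u _; rewrite -EFinM lee_fin mulr_ge0.
- by apply: measurable_funeM; exact: m4.
apply: ge0_le_integral => //.
- by move=> u _; rewrite adde_ge0// -EFinM lee_fin mulr_ge0.
- by apply: emeasurable_funD => //; apply: measurable_funeM; exact: m4.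
- by apply/measurable_EFinP; exact: measurable_funTS.
move=> u /in_I u2; rewrite -EFinM -EFinD lee_fin indicE.
have [u4|u4] := boolP (u \in I (h / 4)).
  move: u4; rewrite inE => /in_I /gdev /=; lra.
have := gdev _ _ u2; move=> /=; lra.
Qed.

Context (x : T -> S) (eps : T -> R) (f : S -> R -> R) (fup flow l0 h : R).
Hypotheses (mx : measurable_fun setT x) (meps : measurable_fun setT eps).
Hypotheses (flow0 : 0 < flow) (fl_up : flow <= fup) (l00 : 0 < l0) (h0 : 0 < h).
Hypothesis hl : l0 * h <= flow / 4.
Hypothesis fcond : is_cond_density P eps x f.
Hypothesis fae : {ae P, forall w, flow <= f (x w) 0 <= fup /\
  forall u v : R, `|f (x w) u - f (x w) v| <= l0 * `|u - v|}.

Let chi w : R := \1_[set` `[- (h / 2), h / 2]] (eps w).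

Let mchi : measurable_fun setT chi.
Proof. by apply: measurableT_comp meps; exact: measurable_indic. Qed.

Let B : set R := [set` `[- (h / 2), h / 2]].

Let mB : measurable B. Proof. exact: measurable_itv. Qed.

Let mf v : measurable_fun setT (f v).
Proof.
have [mf _ _] := fcond.
exact: (@measurable_fun_pair2 _ _ _ _ _ _ (fun vu => f vu.1 vu.2) v mf).
Qed.

Let f0 v u : 0 <= f v u. Proof. by have [_ + _] := fcond; apply. Qed.

Let chi_set A : measurable A ->
  (\int[P]_(w in x @^-1` A) (chi w)%:E =
   \int[P]_(w in x @^-1` A) \int[leb]_(u in B) (f (x w) u)%:E)%E.
Proof.
move=> mA; have [_ _ /(_ B mB)[_ <-//]] := fcond.
have mxA : measurable (x @^-1` A).
  by rewrite -[X in measurable X]setTI; exact: mx.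
have meB : measurable (eps @^-1` B).
  by rewrite -[X in measurable X]setTI; exact: meps.
by rewrite -integral_indic.
Qed.

Let mq A : measurable A -> measurable_fun (x @^-1` A)
  (fun w => (\int[leb]_(u in B) (f (x w) u)%:E)%E).
Proof.
move=> mA; have [_ _ /(_ B mB)[mq _]] := fcond.
by apply: measurable_funTS; exact: (measurableT_comp mq mx).
Qed.

(** Along [x], the weight [chi] has density the conditional probability that
    [eps] falls in the window, which the Lipschitz bounds confine to
    [[29 / 32 * flow * h, 9 / 8 * fup * h]]. *)
Lemma cond_density_ge (g : S -> R) : measurable_fun setT g ->
  (forall s, 0 <= g s) ->
  (\int[P]_w ((29 / 32 * flow * h)%:E * (g (x w))%:E) <=
   \int[P]_w ((chi w)%:E * (g (x w))%:E))%E.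
Proof.
move=> mg g0.
have ql0 : 0 <= 29 / 32 * flow * h.
  by move: flow0 h0 => ? ?; apply: mulr_ge0; lra.
apply: (@le_integral_weight _ _ _ _ _ P (cst (29 / 32 * flow * h)) chi x x
  (EFin \o g)) => //.
- exact/measurable_EFinP.
move=> A mA; rewrite chi_set//.
have mxA : measurable (x @^-1` A).
  by rewrite -[X in measurable X]setTI; exact: mx.
apply: ae_ge0_le_integral => //.
- by apply/measurable_EFinP; exact: measurable_cst.
- by move=> w _; apply: integral_ge0 => u _; rewrite lee_fin.
- exact: mq.
apply: filterS fae => w [fw flip] _.
exact: (lipschitz_density_lower (mf (x w)) (f0 (x w)) flow0 l00 h0 hl fw flip).
Qed.

Lemma cond_density_le (g : S -> R) : measurable_fun setT g ->
  (forall s, 0 <= g s) ->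
  (\int[P]_w ((chi w)%:E * (g (x w))%:E) <=
   \int[P]_w ((9 / 8 * fup * h)%:E * (g (x w))%:E))%E.
Proof.
move=> mg g0.
have qu0 : 0 <= 9 / 8 * fup * h.
  by move: (lt_le_trans flow0 fl_up) h0 => ? ?; apply: mulr_ge0; lra.
apply: (@le_integral_weight _ _ _ _ _ P chi (cst (9 / 8 * fup * h)) x x
  (EFin \o g)) => //.
- exact/measurable_EFinP.
move=> A mA; rewrite chi_set//.
have mxA : measurable (x @^-1` A).
  by rewrite -[X in measurable X]setTI; exact: mx.
apply: ae_ge0_le_integral => //.
- by move=> w _; apply: integral_ge0 => u _; rewrite lee_fin.
- exact: mq.
- by apply/measurable_EFinP; exact: measurable_cst.
apply: filterS fae => w [fw flip] _.
exact: (lipschitz_density_upper (mf (x w)) (f0 (x w)) flow0 l00 h0 hl fw flip).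
Qed.

End conditional_density.

(** * The whitened design *)

Section whitening.
Context {d : measure_display} {T : measurableType d} {R : realType}.
Context (P : probability T R) {p : nat} (x : {RV P >-> p.-tuple R}).

Lemma measurable_coord j : measurable_fun setT (fun w => tnth (x w) j).
Proof. exact: (measurableT_comp (measurable_tnth j)). Qed.

Lemma measurable_colv_mulmx (A : 'M[R]_p) j :
  measurable_fun setT (fun v : p.-tuple R => (A *m colv v) j 0).
Proof.
under eq_fun do rewrite mxE.
apply: measurable_sum => k; apply: measurable_funM => //.
under eq_fun do rewrite mxE.
exact: measurable_tnth.
Qed.

Section second_moment.
Hypothesis ix : forall j, P.-integrable setT (fun w => (tnth (x w) j ^+ 2)%:E).

Lemma integrable_coordM j k :
  P.-integrable setT (fun w => (tnth (x w) j * tnth (x w) k)%:E).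
Proof.
apply: le_integrable (integrableD measurableT (ix j) (ix k)) => //.
  by apply/measurable_EFinP; apply: measurable_funM; exact: measurable_coord.
move=> w _ /=; rewrite lee_fin [leRHS]ger0_norm ?addr_ge0 ?sqr_ge0//.
rewrite ler_norml; have := sqr_ge0 (tnth (x w) j + tnth (x w) k).
by have := sqr_ge0 (tnth (x w) j - tnth (x w) k); nra.
Qed.

Let dot_sqrE (a : 'cV[R]_p) w : (dot a (colv (x w)) ^+ 2)%:E =
  (\sum_j \sum_k (a j 0 * a k 0)%:E * (tnth (x w) j * tnth (x w) k)%:E)%E.
Proof.
rewrite expr2 /dot mulr_suml -sumEFin; apply: eq_bigr => j _.
rewrite mulr_sumr -sumEFin; apply: eq_bigr => k _.
by rewrite -EFinM !mxE; congr EFin; ring.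
Qed.

Lemma integrable_dot_sqr (a : 'cV[R]_p) :
  P.-integrable setT (fun w => (dot a (colv (x w)) ^+ 2)%:E).
Proof.
under eq_fun do rewrite dot_sqrE.
apply: integrable_sum => // j _; apply: integrable_sum => // k _.
apply: integrableZl => //; exact: integrable_coordM.
Qed.

Lemma expectation_dot_sqr (a : 'cV[R]_p) :
  (\int[P]_w (dot a (colv (x w)) ^+ 2)%:E = (dot a (Sigma P x *m a))%:E)%E.
Proof.
under eq_integral do rewrite dot_sqrE.
have ijk j k : P.-integrable setT
    (fun w => (a j 0 * a k 0)%:E * (tnth (x w) j * tnth (x w) k)%:E)%E.
  apply: integrableZl => //; exact: integrable_coordM.
rewrite integral_sum//; last by move=> j; apply: integrable_sum.
rewrite /dot -sumEFin; apply: eq_bigr => j _.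
rewrite integral_sum// mxE mulr_sumr -sumEFin; apply: eq_bigr => k _.
have ic := integrable_coordM j k.
rewrite integralZl// mxE unlock -[X in (_ * X)%E]fineK ?integrable_fin_num//.
by rewrite -EFinM; congr EFin; ring.
Qed.

End second_moment.

Lemma mxsqrt_cases (A : 'M[R]_p) : mxsqrt A = 0 \/
  (possemidef (mxsqrt A) /\ mxsqrt A *m mxsqrt A = A).
Proof.
rewrite /mxsqrt; case: xgetP => [B _ h|_]; first by right.
by left.
Qed.

(** Without a square root the whitened vector is zero, every truncation level
    is admissible, and the infimum of the levels is [0].  A positive infimum
    thus gives the root, with no spectral theorem. *)
Lemma iota_trunc_sqrt : (0 < p)%N -> 0 < iota_trunc P x (1 / 4) ->
  possemidef (mxsqrt (Sigma P x)) /\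
  mxsqrt (Sigma P x) *m mxsqrt (Sigma P x) = Sigma P x.
Proof.
move=> p0 i0; case: (mxsqrt_cases (Sigma P x)) => // B0; exfalso.
have : iota_trunc P x (1 / 4) <= iota_trunc P x (1 / 4) / 2; last by lra.
have i2 : 0 < iota_trunc P x (1 / 4) / 2 by lra.
apply: inf_lbound; first by exists 0 => c [/ltW].
split => // u _; rewrite unlock (eq_integral (cst 0%E)).
  by rewrite integral_cst// mul0e lee_fin; lra.
have inv0 : invmx (0 : 'M[R]_p) = 0.
  rewrite /invmx; case: ifPn => // U; exfalso.
  have /matrixP/(_ (Ordinal p0) (Ordinal p0)) := mulmxV U.
  by rewrite mul0mx !mxE eqxx => /eqP; rewrite eq_sym oner_eq0.
move=> w _; rewrite /whitened B0 inv0 mul0mx.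
by rewrite /dot big1 ?expr2 ?mul0r// => j _; rewrite mxE mulr0.
Qed.

(** The infimum need not be one of the admissible levels, but some level close
    to it is. *)
Lemma iota_trunc_witness (m : R) :
  0 < iota_trunc P x (1 / 4) -> iota_trunc P x (1 / 4) <= m ->
  exists c, [/\ 0 <= c, c <= 5 / 4 * m & forall u : 'cV[R]_p, dot u u = 1 ->
    ('E_P[fun w => (dot u (whitened P x w) ^+ 2
      * \1_[set w' | c < `|dot u (whitened P x w')|] w)%R] <= (1 / 4)%:E)%E].
Proof.
move=> i0 im; set E := [set c : R | 0 < c /\ forall u : 'cV[R]_p, norm2 u = 1 ->
    ('E_P[fun w => (dot u (whitened P x w) ^+ 2
      * \1_[set w' | c < `|dot u (whitened P x w')|] w)%R] <= (1 / 4)%:E)%E].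
have m0 : 0 < m by apply: lt_le_trans im.
have Einf : has_inf E.
  split; last by exists 0 => c [/ltW].
  apply/set0P/eqP => E0; move: i0; rewrite /iota_trunc -/E E0 inf0; lra.
have m4 : 0 < m / 4 by lra.
have [c [c0 cE] cm] := inf_adherent m4 Einf.
exists c; split => [||u /norm2_eq1]; [exact: ltW| |exact: cE].
have : inf E <= m by []; lra.
Qed.

Section inverse.
Hypothesis ix : forall j, P.-integrable setT (fun w => (tnth (x w) j ^+ 2)%:E).
Hypothesis S0 : posdef (Sigma P x).
Local Notation B := (mxsqrt (Sigma P x)).
Local Notation W := (whitened P x).
Hypothesis BT : B^T = B.
Hypothesis BB : B *m B = Sigma P x.

Lemma mxsqrt_unit : B \in unitmx.
Proof.
rewrite unitmxE unitfE; apply/negP => /det0P [v v0 vB].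
have : 0 < dot v^T (Sigma P x *m v^T).
  by apply: S0.2; apply: contra_neq v0 => vT0; rewrite -[v]trmxK vT0 trmx0.
have -> : Sigma P x *m v^T = 0.
  by rewrite -BB -mulmxA -{2}BT -trmx_mul vB trmx0 mulmx0.
by rewrite /dot big1 ?ltxx// => j _; rewrite !mxE mulr0.
Qed.

Lemma dot_whitened (u : 'cV[R]_p) w :
  dot u (W w) = dot (invmx B *m u) (colv (x w)).
Proof. by rewrite /whitened dot_mulmxr trmx_inv BT. Qed.

Lemma integrable_whitened_sqr (u : 'cV[R]_p) :
  P.-integrable setT (fun w => (dot u (W w) ^+ 2)%:E).
Proof. by under eq_fun do rewrite dot_whitened; exact: integrable_dot_sqr. Qed.

Lemma expectation_whitened_sqr (u : 'cV[R]_p) :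
  (\int[P]_w (dot u (W w) ^+ 2)%:E = (dot u u)%:E)%E.
Proof.
under eq_integral do rewrite dot_whitened.
rewrite expectation_dot_sqr//; set a := invmx B *m u.
have -> : Sigma P x *m a = B *m (B *m a) by rewrite mulmxA BB.
by rewrite dot_mulmxr BT /a mulmxA mulmxV ?mxsqrt_unit// mul1mx.
Qed.

Let whitened_coord w j : W w j 0 = dot (delta_mx j 0) (W w).
Proof.
have dE k : delta_mx j 0 k 0 = (k == j)%:R :> R by rewrite mxE eqxx andbT.
rewrite /dot (bigD1 j)//= dE eqxx mul1r big1 ?addr0// => k /negbTE kj.
by rewrite dE kj mul0r.
Qed.

Let dot_whitened_diag w :
  (dot (W w) (W w))%:E = (\sum_j (dot (delta_mx j 0) (W w) ^+ 2)%:E)%E.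
Proof.
rewrite sumEFin; congr EFin; apply: eq_bigr => j _.
by rewrite -whitened_coord expr2.
Qed.

Lemma integrable_whitened_diag :
  P.-integrable setT (fun w => (dot (W w) (W w))%:E).
Proof.
under eq_fun do rewrite dot_whitened_diag.
by apply: integrable_sum => // j _; exact: integrable_whitened_sqr.
Qed.

Lemma expectation_whitened_diag :
  (\int[P]_w (dot (W w) (W w))%:E = p%:R%:E)%E.
Proof.
under eq_integral do rewrite dot_whitened_diag.
rewrite integral_sum//; last by move=> j; exact: integrable_whitened_sqr.
rewrite (eq_bigr (fun=> 1%:E)) => [|j _]; last first.
  rewrite expectation_whitened_sqr; congr EFin.
  rewrite /dot (bigD1 j)//= mxE !eqxx mul1r big1 ?addr0// => k /negbTE kj.
  by rewrite !mxE kj mul0r.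
by rewrite sumEFin sumr_const card_ord.
Qed.

Lemma measurable_whitened (u : 'cV[R]_p) :
  measurable_fun setT (fun w => dot u (W w)).
Proof.
apply: measurable_dot => j.
exact: (measurableT_comp (measurable_colv_mulmx (invmx B) j)).
Qed.

Lemma expectation_truncsq_whitened (u : 'cV[R]_p) (c : R) : dot u u = 1 ->
  ('E_P[fun w => (dot u (W w) ^+ 2
      * \1_[set w' | c < `|dot u (W w')|] w)%R] <= (1 / 4)%:E)%E ->
  ((3 / 4)%:E <= \int[P]_w (truncsq c (dot u (W w)))%:E)%E.
Proof.
move=> u1; rewrite unlock => tail.
have mW := measurable_whitened u.
have mI : measurable [set w' | c < `|dot u (W w')|].
  rewrite (_ : mkset _ =
      ~` (setT `&` [set w' | `|dot u (W w')| <= c])); last first.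
    by rewrite setTI; apply/seteqP; split=> w /=; rewrite ltNge => /negP.
  apply: measurableC; apply: measurable_fun_le => //.
  exact: measurableT_comp.
have := expectation_whitened_sqr u; rewrite u1.
rewrite (_ : (fun w => (dot u (W w) ^+ 2)%:E) = (fun w =>
    (truncsq c (dot u (W w)))%:E + (dot u (W w) ^+ 2
      * \1_[set w' | c < `|dot u (W w')|] w)%:E)%E); last first.
  apply/funext => w; rewrite -EFinD /truncsq indicE; congr EFin.
  case: (leP `|dot u (W w)| c) => h.
    by rewrite memNset ?mulr0 ?addr0//= ltNge h.
  by rewrite mem_set// mulr1 add0r.
rewrite ge0_integralD//; last 4 first.
- by move=> w _; rewrite lee_fin truncsq_ge0.
- by apply/measurable_EFinP; exact: measurable_truncsq.
- by move=> w _; rewrite lee_fin mulr_ge0// sqr_ge0.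
- apply/measurable_EFinP; apply: measurable_funM; first exact: measurable_funX.
  exact: measurable_indic.
move=> h; rewrite -(leeD2rE (x := (1 / 4)%:E))// -EFinD.
apply: (@le_trans _ _ 1%E); first by rewrite lee_fin; lra.
by rewrite -h leeD2l.
Qed.

End inverse.
End whitening.

(** * The smoothed kernel and the Bregman divergence *)

Section smoothed_kernel.
Context {R : realType}.
Variables (K : R -> R) (h : R).
Hypothesis hK : is_kernel K.
Hypothesis h0 : 0 < h.
Local Notation leb := (@lebesgue_measure R).

Let integrable_kernel (D : set (measurableTypeR R)) :
  measurable D -> leb.-integrable D (EFin \o K).
Proof.
move=> mD; apply: (@integrableS _ _ _ leb setT) => //.
have [mK _ K0 K1 _] := hK.
apply/integrableP; split; first exact/measurable_EFinP.
apply: (@le_lt_trans _ _ 1%E); last exact: ltry.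
rewrite -K1 le_eqVlt; apply/orP; left; apply/eqP.
by apply: eq_integral => u _ /=; rewrite ger0_norm.
Qed.

Let integrable_cst_itv (a b c : R) :
  leb.-integrable [set` `]b, a]] (EFin \o cst c).
Proof.
apply: measurable_bounded_integrable => //; last first.
  by exists `|c|; split; [exact: num_real|move=> M cM u _; exact: ltW].
rewrite -[X in (X < _)%E]/(leb _).
by rewrite lebesgue_measure_itv/=; case: ifP => // _; rewrite -EFinB ltry.
Qed.

Let Rintegral_cst_itv (a b c : R) : b <= a ->
  \int[leb]_(v in `]b, a]) c = c * (a - b).
Proof.
move=> ba; rewrite Rintegral_cst// -[X in fine X]/(leb _).
rewrite lebesgue_measure_itv/= lte_fin.
case: ltP => [_|ab]; first by rewrite -EFinB.
by have -> : a = b; [apply/eqP; rewrite eq_le ab ba|rewrite subrr].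
Qed.

Let div_mono (a b : R) : b <= a -> b / h <= a / h.
Proof. by move=> ba; rewrite ler_wpM2r// invr_ge0 ltW. Qed.

Lemma smoothK_sub a b : b <= a ->
  smoothK K h a - smoothK K h b = \int[leb]_(v in `]b / h, a / h]) K v.
Proof.
move=> ba; rewrite /smoothK Rintegral_itvB//; first exact: integrable_kernel.
by rewrite bnd_simp div_mono.
Qed.

Lemma smoothK_mono a b : b <= a -> 0 <= smoothK K h a - smoothK K h b.
Proof.
move=> ba; rewrite smoothK_sub//; apply: Rintegral_ge0 => v _.
by have [_ _ + _ _] := hK; apply.
Qed.

Lemma kappa_l_le u : `|u| <= 1 -> kappa_l K <= K u.
Proof.
move=> u1; apply: inf_lbound; last by exists u.
by exists 0 => _ [v _ <-]; have [_ _ + _ _] := hK; apply.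
Qed.

Lemma smoothK_ge a b : b <= a -> `|b| <= h -> `|a| <= h ->
  kappa_l K / h * (a - b) <= smoothK K h a - smoothK K h b.
Proof.
move=> ba; rewrite !ler_norml => /andP[hb _] /andP[_ ah].
have -> : kappa_l K / h * (a - b) = kappa_l K * (a / h - b / h).
  by rewrite mulrBr mulrBr; ring.
rewrite smoothK_sub// -Rintegral_cst_itv ?div_mono//.
apply: le_Rintegral => //.
- exact: integrable_cst_itv.
- exact: integrable_kernel.
move=> v; rewrite /= in_itv/= => /andP[bv va]; apply: kappa_l_le.
rewrite ler_norml; apply/andP; split.
  rewrite (le_trans _ (ltW bv))// ler_pdivlMr// mulN1r//.
by rewrite (le_trans va)// ler_pdivrMr// mul1r.
Qed.

Lemma smoothK_lipschitz : exists2 M, 0 < M & forall a b,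
  `|smoothK K h a - smoothK K h b| <= M * `|a - b|.
Proof.
have [_ _ K0 _ [M KM]] := hK.
have M0 : 0 <= M by rewrite (le_trans (K0 0))//; apply: KM; exists 0.
have H a b : b <= a -> smoothK K h a - smoothK K h b <= M / h * (a - b).
  move=> ba; have -> : M / h * (a - b) = M * (a / h - b / h).
    by rewrite mulrBr mulrBr; ring.
  rewrite smoothK_sub// -Rintegral_cst_itv ?div_mono//.
  apply: le_Rintegral => //.
  - exact: integrable_kernel.
  - exact: integrable_cst_itv.
  by move=> v _; apply: KM; exists v.
have Mh : 0 <= M / h by rewrite divr_ge0// ltW.
have H' a b : b <= a -> smoothK K h a - smoothK K h b <= (M / h + 1) * (a - b).
  move=> ba; rewrite (le_trans (H _ _ ba))// ler_wpM2r ?subr_ge0// lerDl.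
  exact: ler01.
exists (M / h + 1) => [|a b]; first exact: ltr_wpDl.
case: (leP b a) => [ba|/ltW ab].
  rewrite (ger0_norm (smoothK_mono ba)) [`|a - b|]ger0_norm ?subr_ge0//.
  exact: H'.
rewrite distrC (distrC a) (ger0_norm (smoothK_mono ab)).
by rewrite [`|b - a|]ger0_norm ?subr_ge0//; exact: H'.
Qed.

Lemma smoothK_continuous : continuous (smoothK K h).
Proof.
have [M M0 lip] := smoothK_lipschitz.
move=> a; apply/cvgrPdist_le => e e0; near=> b.
rewrite (le_trans (lip _ _))// -ler_pdivlMl// mulrC.
near: b; apply: cvgr_dist_le; first exact: cvg_id.
by rewrite divr_gt0.
Unshelve. all: by end_near. Qed.

Lemma smoothK_measurable : measurable_fun setT (smoothK K h).
Proof. apply: continuous_measurable_fun; exact: smoothK_continuous. Qed.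

(** Each summand of the Bregman divergence is a product of two factors of the
    same sign, and the first one is an integral of the kernel over a window
    that the two conditions keep inside the unit interval. *)
Lemma smoothK_increment_ge (s e : R) : `|e| <= h / 2 ->
  kappa_l K / h * truncsq (h / 2) s <=
  (smoothK K h (s - e) - smoothK K h (- e)) * s.
Proof.
move=> he; rewrite /truncsq; case: ifPn => [hs|_]; last first.
  rewrite mulr0; case: (leP 0 s) => s0.
    by rewrite mulr_ge0// smoothK_mono// lerDr.
  by rewrite nmulr_lge0// -oppr_ge0 opprB smoothK_mono// gerDr ltW.
move: (h0) (he) (hs) => hh; rewrite !ler_norml => /andP[e1 e2] /andP[s1 s2].
have n1 : `|- e| <= h by rewrite ler_norml; apply/andP; split; lra.
have n2 : `|s - e| <= h by rewrite ler_norml; apply/andP; split; lra.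
have {1}-> : s ^+ 2 = s * s by [].
case: (leP 0 s) => s0; rewrite mulrA.
  rewrite ler_wpM2r//; have := @smoothK_ge (s - e) (- e) _ n1 n2.
  by rewrite opprK subrK; apply; rewrite lerDr.
rewrite ler_wnM2r ?(ltW s0)//.
have := @smoothK_ge (- e) (s - e) _ n2 n1; rewrite gerDr (ltW s0) => /(_ isT).
have -> : - e - (s - e) = - s by ring.
by rewrite mulrN lerNl opprB.
Qed.

Lemma smoothK_increment_ge0 (s e : R) :
  0 <= (smoothK K h (s - e) - smoothK K h (- e)) * s.
Proof.
case: (leP 0 s) => s0; first by rewrite mulr_ge0// smoothK_mono// lerDr.
by rewrite nmulr_lge0// -oppr_ge0 opprB smoothK_mono// gerDr ltW.
Qed.

Section bregman.
Variables (tau : R) (n p : nat) (ys : 'I_n -> R) (xs : 'I_n -> 'cV[R]_p).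
Variable b : 'cV[R]_p.

Lemma bregmanE (delta : 'cV[R]_p) :
  bregman K h tau ys xs (b + delta) b =
  n%:R^-1 * \sum_i (smoothK K h (dot (xs i) delta - (ys i - dot (xs i) b))
    - smoothK K h (- (ys i - dot (xs i) b))) * dot (xs i) delta.
Proof.
have bd : b + delta - b = delta by rewrite addrAC subrr add0r.
rewrite /bregman bd /gradQ -scalerBr dotZl; congr (_ * _).
rewrite -sumrB dot_suml; apply: eq_bigr => i _.
rewrite -scalerBl dotZl; congr (_ * _).
rewrite dotDr.
have -> : dot (xs i) b + dot (xs i) delta - ys i =
    dot (xs i) delta - (ys i - dot (xs i) b) by ring.
by rewrite (opprB (ys i)); ring.
Qed.

Lemma bregman_ge0 delta : 0 <= bregman K h tau ys xs (b + delta) b.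
Proof.
rewrite bregmanE mulr_ge0 ?invr_ge0//; apply: sumr_ge0 => i _.
exact: smoothK_increment_ge0.
Qed.

Lemma bregman_ge delta :
  n%:R^-1 * \sum_i \1_[set` `[- (h / 2), h / 2]] (ys i - dot (xs i) b) *
    (kappa_l K / h * truncsq (h / 2) (dot (xs i) delta)) <=
  bregman K h tau ys xs (b + delta) b.
Proof.
rewrite bregmanE ler_wpM2l ?invr_ge0//; apply: ler_sum => i _.
rewrite indicE; case: (boolP (_ \in _)) => [|_]; last first.
  by rewrite mul0r smoothK_increment_ge0.
by rewrite inE /= in_itv/= -ler_norml mul1r; exact: smoothK_increment_ge.
Qed.

End bregman.
End smoothed_kernel.

(** * Continuity and rational vectors *)

Section countable_reduction.
Context {R : realType} {p : nat}.

Lemma ratr_mx_dense (v : 'cV[R]_p) (V : set 'cV[R]_p) : nbhs v V ->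
  exists q : 'cV[rat]_p, V (map_mx ratr q).
Proof.
move=> /nbhs_ballP[e e0 eV].
have H j : exists q : rat, `|v j 0 - ratr q| < e.
  have /rat_in_itvoo[q /itvP qv] : v j 0 < v j 0 + e by rewrite ltrDl.
  exists q; rewrite distrC ger0_norm ?subr_ge0 ?(ltW _) ?qv//.
  by rewrite ltrBlDl qv.
have [q qP] := choice H.
exists (\col_j q j); apply: eV; split => // i j.
by rewrite ord1 !mxE; exact: qP.
Qed.

(** A failure at [u] persists near [u], hence at some rational vector inside
    [U]. *)
Lemma measurable_forall_vector d (T : measurableType d)
    (G : T -> 'cV[R]_p -> R) (U : set 'cV[R]_p) :
  (forall u, measurable_fun setT (G ^~ u)) -> (forall w, continuous (G w)) ->
  U `<=` closure U° ->
  measurable [set w | forall u, U u -> 0 <= G w u].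
Proof.
move=> mG cG UU.
rewrite (_ : mkset _ = ~` \bigcup_(q : 'cV[rat]_p)
    [set w | U (map_mx ratr q) /\ G w (map_mx ratr q) < 0]); last first.
  apply/seteqP; split=> w /= h.
    by move=> [q _ /= [Uq]]; rewrite ltNge h.
  move=> u Uu; rewrite leNgt; apply/negP => Gu.
  have V : nbhs u [set v | G w v < 0].
    exact: (cvgr_lt (G w u) (cG w u)).
  have [v [Uv Vv]] := UU u Uu _ (nbhs_interior V).
  have [q [qU qV]] := ratr_mx_dense (filterI (nbhs_interior Uv) Vv).
  by apply: h; exists q => //; split => //; exact: interior_subset qU.
apply: measurableC; apply: countable_bigcupT_measurable => // q.
have [Uq|nUq] := pselect (U (map_mx ratr q)); last first.
  by rewrite (_ : mkset _ = set0)//; apply/seteqP; split=> w // -[].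
rewrite (_ : mkset _ = ~` (setT `&` [set w | cst 0 w <= G w (map_mx ratr q)])).
  by apply: measurableC; apply: measurable_fun_le.
rewrite setTI; apply/seteqP; split=> w /=; rewrite ltNge.
  by move=> [_ /negP].
by move=> /negP.
Qed.

End countable_reduction.

Section continuity.
Context {R : realType} {p : nat}.

Lemma sum_continuous (X : topologicalType) n (F : 'I_n -> X -> R) :
  (forall i, continuous (F i)) -> continuous (fun u => \sum_i F i u).
Proof. by move=> cF; apply: continuous_big => //; exact: add_continuous. Qed.

Lemma subf_continuous (X : topologicalType) (f g : X -> R) :
  continuous f -> continuous g -> continuous (fun u => f u - g u).
Proof. by move=> cf cg u; exact: cvgB (cf u) (cg u). Qed.

Lemma mulf_continuous (X : topologicalType) (f g : X -> R) :
  continuous f -> continuous g -> continuous (fun u => f u * g u).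
Proof. by move=> cf cg u; exact: cvgM (cf u) (cg u). Qed.

Lemma compf_continuous (X : topologicalType) (f : X -> R) (g : R -> R) :
  continuous f -> continuous g -> continuous (fun u => g (f u)).
Proof. by move=> cf cg u; exact: continuous_comp (cf u) (cg (f u)). Qed.

Lemma dot_continuous (X : topologicalType) (f g : X -> 'cV[R]_p) :
  (forall j, continuous (fun u => f u j 0)) ->
  (forall j, continuous (fun u => g u j 0)) ->
  continuous (fun u => dot (f u) (g u)).
Proof.
move=> cf cg; apply: sum_continuous => j u.
exact: (continuousM (cf j u) (cg j u)).
Qed.

Lemma mulmx_coord_continuous (A : 'M[R]_p) j :
  continuous (fun u : 'cV[R]_p => (A *m u) j 0).
Proof.
under eq_fun do rewrite mxE.
apply: sum_continuous => k u; apply: continuousM; first exact: cst_continuous.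
exact: coord_continuous.
Qed.

Lemma dotr_continuous (v : 'cV[R]_p) : continuous (dot v).
Proof.
apply: dot_continuous => j; first exact: cst_continuous.
exact: coord_continuous.
Qed.

Context {d : measure_display} {T : measurableType d} (P : probability T R)
  (x : T -> p.-tuple R).

Lemma normSigma_sqr u :
  normSigma P x u ^+ 2 =
    dot (mxsqrt (Sigma P x) *m u) (mxsqrt (Sigma P x) *m u).
Proof. by rewrite sqr_sqrtr// dot_ge0. Qed.

Lemma normSigma_ge0 u : 0 <= normSigma P x u.
Proof. exact: sqrtr_ge0. Qed.

Lemma normSigma_sqr_continuous : continuous (fun u => normSigma P x u ^+ 2).
Proof.
under eq_fun do rewrite normSigma_sqr.
apply: dot_continuous => j; exact: mulmx_coord_continuous.
Qed.

Lemma normSigma_continuous : continuous (normSigma P x).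
Proof.
move=> u; apply: (@continuous_comp _ _ _ (fun u => dot _ _) Num.sqrt).
  by apply: dot_continuous => j; exact: mulmx_coord_continuous.
exact: sqrt_continuous.
Qed.

Lemma normSigmaZ (s : R) u : 0 <= s ->
  normSigma P x (s *: u) = s * normSigma P x u.
Proof.
move=> s0; rewrite /normSigma /norm2 -scalemxAr dotZl dotZr mulrA.
by rewrite sqrtrM ?mulr_ge0// -expr2 sqrtr_sqr ger0_norm.
Qed.

(** Shrinking a vector of the ball moves it to the interior. *)
Lemma Theta_closure_interior (r : R) : 0 < r ->
  Theta P x r `<=` closure (Theta P x r)°.
Proof.
move=> r0 u ur V uV.
have : nbhs (1 : R) [set s : R | V (s *: u)].
  have := @scalel_continuous R _ u 1.
  by rewrite /continuous_at scale1r => /(_ _ uV).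
move=> /nbhs_ballP[e /= e0 eV].
pose s := 1 - Num.min (e / 2) (1 / 2).
have m0 : 0 < Num.min (e / 2) (1 / 2) by rewrite lt_min; apply/andP; split; lra.
have m1 : Num.min (e / 2) (1 / 2) <= 1 / 2 by rewrite ge_min lexx orbT.
have m2 : Num.min (e / 2) (1 / 2) <= e / 2 by rewrite ge_min lexx.
exists (s *: u); split.
  have : normSigma P x (s *: u) < r.
    rewrite normSigmaZ; last by rewrite /s; lra.
    have := ur; rewrite /Theta /= => ur'; have := normSigma_ge0 u.
    rewrite /s; nra.
  move=> su; have :=
    cvgr_lt (normSigma P x (s *: u)) (@normSigma_continuous (s *: u)) r su.
  by move=> /(_ _); apply: filterS => v; exact: ltW.
apply: eV; rewrite /ball /= /s opprB addrC subrK ger0_norm; lra.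
Qed.

End continuity.

(** * Rates *)

Section arithmetic.
Context {R : realType}.

(** The mesh of the grid is [1 / K] in the natural unit [sqrt (flow / (fup p))].
    The value [K = 256] makes the rounding error at most [flow * h / 80] per
    observation, and the constant [8 * K] is such that the grid cost, at most
    [64 * K ^+ 2 * A ^+ 2 / flow], is bounded by [8 * K * A] as soon as
    [8 * K * A <= flow]. *)
Lemma rate_arithmetic (K flow fup h r t A n p X : R) :
  K = 256 -> 0 < flow -> flow <= fup -> 0 < h -> 0 < r -> 0 < n -> 0 < p ->
  0 <= t -> 0 <= A -> A ^+ 2 = fup * (p * h / n) / r ^+ 2 ->
  8 * K * A <= flow ->
  n * (199 / 201 * (3 / 4 * (29 / 32 * flow * h))
      - 601 * (flow / (fup * p * K ^+ 2)) * (9 / 8 * fup * h * p))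
    - 600 * (h / (4 * r)) ^+ 2 * (t + 3 * p + (flow / (fup * p * K ^+ 2))^-1)
  <= 201 / 200 * X ->
  21 / 32 * flow - 8 * K * (A + h * t / (r ^+ 2 * n)) <= X / (n * h).
Proof.
move=> KE flow0 ff h0 r0 n0 p0 t0 A0 A2 KA.
have fup0 : 0 < fup by lra.
have K0 : 0 < K by lra.
have K2 : 0 < K ^+ 2 by rewrite exprn_gt0.
have neq : (flow != 0) * (fup != 0) * (h != 0) * (r != 0) * (n != 0) *
  (p != 0) * (K != 0) by rewrite !gt_eqF.
set E := 601 * _ * _.
have -> : E = (601 * (9 / 8) / K / K) * (flow * h).
  by rewrite /E; field; rewrite !neq.
have K1 : 601 * (9 / 8) / K / K <= 1 / 80.
  by rewrite ler_pdivrMr// ler_pdivrMr//; rewrite KE; lra.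
set L := 600 * _ * _.
have -> : L = n * h * (75 / 2 * (h * t / (r ^+ 2 * n)) +
    75 / 2 * (A ^+ 2 / flow) * (3 * (flow / fup) + K ^+ 2)).
  by rewrite /L A2; field; rewrite !neq.
move=> H.
have nh0 : 0 < n * h by rewrite mulr_gt0.
rewrite ler_pdivlMr//.
set Tt := h * t / (r ^+ 2 * n) in H *.
have T0 : 0 <= Tt by rewrite divr_ge0// mulr_ge0// ltW// exprn_gt0.
have loss : 75 / 2 * (A ^+ 2 / flow) * (3 * (flow / fup) + K ^+ 2) <= 8 * K * A.
  have fr : 3 * (flow / fup) <= 3 by rewrite ler_piMr// ler_pdivrMr// mul1r.
  have KK : 3 <= K * K / 4 by rewrite KE; lra.
  have h1 : 75 / 2 * (3 * (flow / fup) + K ^+ 2) <= 64 * K ^+ 2.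
    by rewrite expr2; lra.
  have -> : 75 / 2 * (A ^+ 2 / flow) * (3 * (flow / fup) + K ^+ 2) =
    A ^+ 2 / flow * (75 / 2 * (3 * (flow / fup) + K ^+ 2)) by ring.
  apply: (@le_trans _ _ (A ^+ 2 / flow * (64 * K ^+ 2))).
    by rewrite ler_wpM2l// divr_ge0 ?sqr_ge0// ltW.
  have -> : A ^+ 2 / flow * (64 * K ^+ 2) = 8 * K * A * (8 * K * A / flow).
    by field; rewrite !neq.
  rewrite ler_piMr//; first by rewrite !mulr_ge0// ltW.
  by rewrite ler_pdivrMr// mul1r.
set Ls := 75 / 2 * (A ^+ 2 / flow) * _ in H loss.
have fh0 : 0 <= flow * h by rewrite mulr_ge0// ltW.
set x := 601 * (9 / 8) / K / K in H K1.
have h1 : x * (flow * h) <= 1 / 80 * (flow * h) by rewrite ler_wpM2r.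
have h2 := ler_wpM2l (ltW n0) h1.
have h3 : n * h * Ls <= n * h * (8 * K * A) by rewrite ler_wpM2l// ltW.
have KT : 75 / 2 * Tt <= 8 * K * Tt by rewrite ler_wpM2r//; rewrite KE; lra.
have h4 : n * h * (75 / 2 * Tt) <= n * h * (8 * K * Tt).
  by rewrite ler_wpM2l// ltW.
have h5 : 0 <= n * (flow * h) by rewrite mulr_ge0// ltW.
have h6 : 0 <= n * h * (8 * K * A) by rewrite !mulr_ge0// ltW.
have h7 : 0 <= n * h * (8 * K * Tt).
  by rewrite mulr_ge0 ?(ltW nh0)// mulr_ge0// mulr_ge0// ltW.
set a1 := n * h * (8 * K * A) in h3 h6.
set a2 := n * h * (8 * K * Tt) in h4 h7.
have -> : (21 / 32 * flow - 8 * K * (A + Tt)) * (n * h) =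
  21 / 32 * (n * (flow * h)) - a1 - a2 by rewrite /a1 /a2; ring.
set a3 := n * (flow * h) in h5 *.
have H' : 199 / 201 * (3 / 4 * (29 / 32)) * a3 - n * (x * (flow * h)) -
    (n * h * (75 / 2 * Tt) + n * h * Ls) <= 201 / 200 * X.
  apply: le_trans H; rewrite le_eqVlt; apply/orP; left; apply/eqP.
  by rewrite /a3; ring.
have h2' : n * (x * (flow * h)) <= 1 / 80 * a3.
  apply: (le_trans h2); rewrite le_eqVlt; apply/orP; left; apply/eqP.
  by rewrite /a3; ring.
move: H' h2' h3 h4 h5 h6 h7; clear.
set b1 := n * (x * (flow * h)); set b2 := n * h * Ls.
set b3 := n * h * (75 / 2 * Tt).
move=> H' h2 h3 h4 h5 h6 h7.
clearbody a1 a2 a3 b1 b2 b3.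
lra.
Qed.

End arithmetic.

(** * The divergence on the whole ball *)

Section regression.
Context {d : measure_display} {T : measurableType d} {R : realType}.
Context (P : probability T R) {p n : nat}.

Lemma measurable_dot_colv (v : 'cV[R]_p) :
  measurable_fun setT (fun a : p.-tuple R => dot (colv a) v).
Proof.
under eq_fun do rewrite dotC.
apply: measurable_dot => j; under eq_fun do rewrite mxE.
exact: measurable_tnth.
Qed.

Variables (K : R -> R) (h tau : R) (b : 'cV[R]_p) (x : T -> p.-tuple R).
Hypotheses (hK : is_kernel K) (h0 : 0 < h).

Lemma bregman_measurable (xs : 'I_n -> {RV P >-> p.-tuple R})
    (ys : 'I_n -> {RV P >-> R}) (u : 'cV[R]_p) :
  measurable_fun setT (fun w => bregman K h tau (fun i => ys i w)
    (fun i => colv (xs i w)) (b + u) b).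
Proof.
under eq_fun do rewrite bregmanE.
have mx i v : measurable_fun setT (fun w => dot (colv (xs i w)) v).
  exact: (measurableT_comp (measurable_dot_colv v)).
apply: measurable_funM => //; apply: measurable_sum => i.
have me : measurable_fun setT (fun w => ys i w - dot (colv (xs i w)) b).
  exact: measurable_funB.
apply: measurable_funM => //; apply: measurable_funB.
  apply: measurableT_comp; first exact: smoothK_measurable.
  exact: measurable_funB.
apply: measurableT_comp; first exact: smoothK_measurable.
exact: measurableT_comp.
Qed.

Lemma bregman_continuous (xs : 'I_n -> 'cV[R]_p) (ys : 'I_n -> R) :
  continuous (fun u => bregman K h tau ys xs (b + u) b).
Proof.
under eq_fun do rewrite bregmanE.
apply: mulf_continuous; first exact: cst_continuous.
apply: sum_continuous => i.
apply: mulf_continuous; last exact: dotr_continuous.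
apply: subf_continuous; last exact: cst_continuous.
have cx : continuous (fun u : 'cV[R]_p =>
    dot (xs i) u - (ys i - dot (xs i) b)).
  by apply: subf_continuous; [exact: dotr_continuous|exact: cst_continuous].
exact: (compf_continuous cx (smoothK_continuous hK h0)).
Qed.

(** The infimum runs over an uncountable set; by continuity in [delta] it can
    be taken over rational vectors, so the event is measurable. *)
Lemma bregman_event_measurable (xs : 'I_n -> {RV P >-> p.-tuple R})
    (ys : 'I_n -> {RV P >-> R}) (r c : R) : 0 < r ->
  measurable [set w | forall u, Theta P x r u ->
    0 <= bregman K h tau (fun i => ys i w) (fun i => colv (xs i w)) (b + u) b
         - c * normSigma P x u ^+ 2].
Proof.
move=> r0; apply: measurable_forall_vector; last exact: Theta_closure_interior.
  by move=> u; apply: measurable_funB => //; exact: bregman_measurable.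
move=> w; apply: subf_continuous; first exact: bregman_continuous.
apply: mulf_continuous; first exact: cst_continuous.
exact: normSigma_sqr_continuous.
Qed.

End regression.

Theorem lemmaC3 (R : realType) :
  exists c1 : R, 0 < c1 /\
  forall (d : measure_display) (T : measurableType d) (P : probability T R)
    (tau : R) (p n : nat)
    (x : {RV P >-> p.-tuple R}) (eps : {RV P >-> R})
    (betastar : 'cV[R]_p)
    (f : p.-tuple R -> R -> R)
    (xs : 'I_n -> {RV P >-> p.-tuple R}) (ys : 'I_n -> {RV P >-> R})
    (K : R -> R) (fup flow l0 v0 h r t : R),
  0 < tau < 1 -> (2 <= p)%N -> (0 < n)%N ->
  (forall (j : 'I_p) (w : T), val j = 0%N -> tnth (x w) j = 1) ->
  (forall j : 'I_p, (0 < val j)%N -> 'E_P[fun w => tnth (x w) j]%E = 0%E) ->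
  (forall j : 'I_p,
     P.-integrable setT (fun w => (tnth (x w) j ^+ 2)%:E)) ->
  posdef (Sigma P x) ->
  is_cond_prob P [set w | eps w <= 0] x (fun=> tau%:E) ->
  is_cond_density P eps x f ->
  iid_copies P (fun i w => (ys i w, xs i w))
    (fun w => (dot (colv (x w)) betastar + eps w, x w)) ->
  is_kernel K ->
  0 < flow -> flow <= fup -> 0 < l0 ->
  {ae P, forall w, flow <= f (x w) 0 <= fup /\
     forall u v : R, `|f (x w) u - f (x w) v| <= l0 * `|u - v|} ->
  0 < v0 -> subexp_design P x v0 ->
  0 < kappa_l K ->
  0 < h -> h <= flow / (4 * l0) ->
  0 < r -> r <= h / (4 * iota_trunc P x (1 / 4)) ->
  0 <= t ->
  (P [set w |
      ((21 / 32 * flow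
        - c1 * (Num.sqrt fup * (1 / r) * Num.sqrt (p%:R * h / n%:R)
                + Num.sqrt (fup * fine (m4 P x)) * Num.sqrt (t / (n%:R * h))
                + h * t / (r ^+ 2 * n%:R)))%:E
       <= ereal_inf
            [set (bregman K h tau (fun i => ys i w) (fun i => colv (xs i w))
                    (betastar + delta) betastar
                  / (kappa_l K * normSigma P x delta ^+ 2))%:E
            | delta in Theta P x r `\` [set 0%R]])%E]
   >= (1 - expR (- t))%:E)%E.
Proof.
have [K256 KE] : exists K256 : R, K256 = 256 by eexists.
have K0 : 0 < K256 by rewrite KE; lra.
exists (8 * K256); split; first by rewrite mulr_gt0.
move=> d T P tau p n x eps betastar f xs ys K fup flow l0 v0 h r t.
move=> _ p2 n0 _ _ ix S0 _ fcond iid hK flow0 ff l00 fae _ _ kap h0 hl r0 rl t0.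
have p0 : (0 < p)%N by exact: leq_trans p2.
have pR : 0 < p%:R :> R by rewrite ltr0n.
have nR : 0 < n%:R :> R by rewrite ltr0n.
have fup0 : 0 < fup by exact: lt_le_trans ff.
set A := Num.sqrt fup * (1 / r) * Num.sqrt (p%:R * h / n%:R).
set M4 := Num.sqrt (fup * fine (m4 P x)) * Num.sqrt (t / (n%:R * h)).
set Tt := h * t / (r ^+ 2 * n%:R).
have A0 : 0 <= A.
  by rewrite /A !mulr_ge0 ?sqrtr_ge0// invr_ge0 ltW.
have M0 : 0 <= M4 by rewrite /M4 mulr_ge0 ?sqrtr_ge0.
have T0 : 0 <= Tt.
  by rewrite /Tt divr_ge0 ?mulr_ge0// ?exprn_ge0// ltW.
set rhs := 21 / 32 * flow - _.
have hl' : l0 * h <= flow / 4.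
  have l4 : 0 < 4 * l0 by rewrite mulr_gt0.
  move: hl; rewrite ler_pdivlMr// => hl; clear -hl; lra.
(* As [0 < r], the quotient [h / (4 * iota)] is positive. *)
have i0 : 0 < iota_trunc P x (1 / 4).
  rewrite ltNge; apply/negP => i0; have := lt_le_trans r0 rl; rewrite ltNge.
  by rewrite mulr_ge0_le0 ?(ltW h0)// invr_le0 mulr_ge0_le0.
have [[BT _] BB] := iota_trunc_sqrt p0 i0.
set B := mxsqrt (Sigma P x) in BT BB.
pose N u := normSigma P x u.
have Nsqr u : N u ^+ 2 = dot (B *m u) (B *m u) by exact: normSigma_sqr.
have Bunit : B \in unitmx by exact: mxsqrt_unit.
have N0 u : u != 0 -> 0 < N u.
  move=> u0; rewrite lt0r normSigma_ge0 andbT -sqrf_eq0 Nsqr gt_eqF//.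
  apply: dot_gt0; apply: contra_neq u0 => Bu0.
  by rewrite -[u]mul1mx -(mulVmx Bunit) -mulmxA Bu0 mulmx0.
pose D w u := bregman K h tau (fun i => ys i w) (fun i => colv (xs i w))
  (betastar + u) betastar.
have eventE : [set w | (rhs%:E <= ereal_inf [set
      (bregman K h tau (fun i => ys i w) (fun i => colv (xs i w))
        (betastar + delta) betastar / (kappa_l K * N delta ^+ 2))%:E
      | delta in Theta P x r `\` [set 0%R]])%E] =
    [set w | forall u, Theta P x r u ->
      0 <= D w u - rhs * kappa_l K * N u ^+ 2].
  apply/seteqP; split => w /= H.
    move=> u Tu; have [->|u0] := eqVneq u 0.
      rewrite subr_ge0 Nsqr mulmx0 /dot big1 => [|j _]; last first.
        by rewrite mxE mul0r.
      by rewrite mulr0 bregman_ge0.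
    rewrite subr_ge0 -mulrA -ler_pdivlMr ?mulr_gt0 ?exprn_gt0 ?N0//.
    rewrite -lee_fin; apply: (le_trans H); apply: ereal_inf_lbound.
    by exists u => //; split => //; exact/eqP.
  apply: le_ereal_inf_tmp => _ [u [Tu /eqP u0] <-].
  rewrite lee_fin ler_pdivlMr ?mulr_gt0 ?exprn_gt0 ?N0//.
  by rewrite mulrA -subr_ge0; exact: H.
rewrite -/N eventE.
set E := mkset _.
have mE : measurable E by exact: bregman_event_measurable.
(* For large [A] the right-hand side is nonpositive. *)
have [triv|] := leP flow (8 * K256 * A).
  have rhs0 : rhs <= 0.
    have : 0 <= 8 * K256 * (M4 + Tt) by rewrite !mulr_ge0 ?addr_ge0// ltW.
    have -> : rhs = 21 / 32 * flow - 8 * K256 * A - 8 * K256 * (M4 + Tt).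
      by rewrite /rhs; ring.
    set s1 := 8 * K256 * A in triv *; set s2 := 8 * _ * _.
    by move=> s20; clearbody s1 s2; clear -s20 triv flow0; lra.
  have -> : E = setT.
    apply/seteqP; split => // w _ u _; rewrite subr_ge0.
    apply: (@le_trans _ _ 0); last exact: bregman_ge0.
    rewrite -mulrA mulr_le0_ge0// mulr_ge0 ?sqr_ge0// ltW//.
  rewrite probability_setT lee_fin lerBlDr lerDl; exact: expR_ge0.
move=> nontriv.
(* Twice this level is the bound on [<u, w>] under which
   [`|<x, delta>| <= h / 2]. *)
pose m := h / (4 * r).
have m0 : 0 < m by rewrite divr_gt0 ?mulr_gt0.
have im : iota_trunc P x (1 / 4) <= m.
  rewrite /m ler_pdivlMr ?mulr_gt0//.
  have := rl; rewrite ler_pdivlMr ?mulr_gt0// => rl'; clear -rl'; lra.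
have [c [c0 cm cP]] := iota_trunc_witness i0 im.
pose dl := Num.sqrt (flow / (fup * p%:R * K256 ^+ 2)).
have dl2 : 0 < flow / (fup * p%:R * K256 ^+ 2).
  by rewrite divr_gt0// !mulr_gt0// exprn_gt0.
have dl0 : 0 < dl by rewrite sqrtr_gt0.
have dlE : dl ^+ 2 = flow / (fup * p%:R * K256 ^+ 2) by rewrite sqr_sqrtr// ltW.
pose I : set R := [set` `[- (h / 2), h / 2]].
pose chi (s : R * p.-tuple R) : R := \1_I (s.1 - dot (colv s.2) betastar).
pose W (s : R * p.-tuple R) : 'cV[R]_p := invmx B *m colv s.2.
pose Z i w := (ys i w, xs i w).
pose Z0 w := (dot (colv (x w)) betastar + eps w, x w).
have chiZ0 w : chi (Z0 w) = \1_I (eps w) by rewrite /chi /= addrC addKr.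
have mZ k : measurable_fun setT (Z k) by exact: measurable_fun_pair.
have mxv v : measurable_fun setT (fun w => dot (colv (x w)) v).
  exact: (measurableT_comp (measurable_dot_colv v)).
have mZ0 : measurable_fun setT Z0.
  by apply: measurable_fun_pair => //; apply: measurable_funD.
have mchi : measurable_fun setT chi.
  apply: measurableT_comp.
    by apply: measurable_indic; exact: measurable_itv.
  apply: measurable_funB => //.
  exact: (measurableT_comp (measurable_dot_colv betastar)).
have mW j : measurable_fun setT (fun s => W s j 0).
  exact: (measurableT_comp (measurable_colv_mulmx (invmx B) j)).
have chi01 s : chi s = 0 \/ chi s = 1.
  by rewrite /chi indicE; case: (_ \in _); [right|left].
have iW : P.-integrable setT (fun w => (dot (W (Z0 w)) (W (Z0 w)))%:E).
  exact: integrable_whitened_diag.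
have mx : measurable_fun setT x by [].
have meps : measurable_fun setT eps by [].
have Hqu : \int[P]_w (chi (Z0 w) * dot (W (Z0 w)) (W (Z0 w))) <=
    9 / 8 * fup * h * p%:R.
  have mWW : measurable_fun setT (fun v : p.-tuple R =>
      dot (invmx B *m colv v) (invmx B *m colv v)).
    by apply: measurable_dot_diag => j; exact: measurable_colv_mulmx.
  have iWW : P.-integrable setT
      (fun w => (chi (Z0 w) * dot (W (Z0 w)) (W (Z0 w)))%:E).
    apply: le_integrable_EFin iW.
      apply: measurable_funM; first exact: (measurableT_comp mchi mZ0).
      exact: (measurableT_comp mWW mx).
    move=> w; case: (chi01 (Z0 w)) => ->; rewrite ?mul0r ?mul1r ?lexx.
      by rewrite dot_ge0.
    by rewrite dot_ge0.
  rewrite -lee_fin /Rintegral fineK ?integrable_fin_num//.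
  have := cond_density_le mx meps flow0 ff l00 h0 hl' fcond fae mWW
    (fun v => dot_ge0 _).
  rewrite ge0_integralZl//; last 3 first.
  - exact/measurable_EFinP/(measurableT_comp mWW mx).
  - by move=> w _; rewrite lee_fin dot_ge0.
  - by rewrite lee_fin !mulr_ge0// ltW.
  rewrite -[X in (_ * X)%E]/(
    \int[P]_w (dot (whitened P x w) (whitened P x w))%:E)%E.
  rewrite expectation_whitened_diag// -EFinM; apply: le_trans.
  rewrite le_eqVlt; apply/orP; left; apply/eqP; apply: eq_integral => w _.
  by rewrite chiZ0 EFinM.
have Hql u : dot u u = 1 -> 3 / 4 * (29 / 32 * flow * h) <=
    \int[P]_w (chi (Z0 w) * truncsq c (dot u (W (Z0 w)))).
  move=> u1.
  have mg : measurable_fun setT (fun v : p.-tuple R =>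
      truncsq c (dot u (invmx B *m colv v))).
    apply: measurable_truncsq; apply: measurable_dot => j.
    exact: measurable_colv_mulmx.
  have ig : P.-integrable setT
      (fun w => (chi (Z0 w) * truncsq c (dot u (W (Z0 w))))%:E).
    apply: (@bounded_integrable_EFin _ _ _ _ _ (c ^+ 2)).
      apply: measurable_funM; first exact: (measurableT_comp mchi mZ0).
      exact: (measurableT_comp mg mx).
    move=> w; case: (chi01 (Z0 w)) => ->; rewrite ?mul0r ?mul1r.
      by rewrite lexx sqr_ge0.
    by rewrite truncsq_ge0 truncsq_le.
  rewrite -lee_fin /Rintegral fineK ?integrable_fin_num//.
  have := cond_density_ge mx meps flow0 l00 h0 hl' fcond fae mg
    (fun v => truncsq_ge0 _ _).
  rewrite ge0_integralZl//; last 3 first.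
  - exact/measurable_EFinP/(measurableT_comp mg mx).
  - by move=> w _; rewrite lee_fin truncsq_ge0.
  - by rewrite lee_fin !mulr_ge0// ltW.
  move=> ge; apply: le_trans; last first.
    apply: (le_trans ge); rewrite le_eqVlt; apply/orP; left; apply/eqP.
    by apply: eq_integral => w _; rewrite chiZ0 EFinM.
  rewrite mulrC EFinM lee_wpmul2l//; first by rewrite lee_fin !mulr_ge0// ltW.
  exact: (expectation_truncsq_whitened ix S0 BT BB u1 (cP u u1)).
have [G [mG PG GP]] := truncsq_sum_lower_tail t iid mZ mZ0 mchi chi01 mW m0 c0
  cm dl0 iW Hqu Hql.
apply: (le_trans PG); apply: le_measure; rewrite ?inE// => w Gw u Tu.
have [->|u0] := eqVneq u 0.
  rewrite subr_ge0 Nsqr mulmx0 /dot big1 => [|j _]; last by rewrite mxE mul0r.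
  by rewrite mulr0 bregman_ge0.
have Nu := N0 u u0.
pose v := (N u)^-1 *: (B *m u).
have v1 : dot v v = 1.
  by rewrite /v dotZl dotZr -Nsqr; field; rewrite gt_eqF.
have := GP w v Gw v1; rewrite dlE => HG.
set X := \sum_k _ in HG.
have A2 : A ^+ 2 = fup * (p%:R * h / n%:R) / r ^+ 2.
  rewrite /A !exprMn !sqr_sqrtr ?divr_ge0 ?mulr_ge0 ?(ltW fup0) ?(ltW h0)//.
  by field; rewrite !gt_eqF.
have rate := rate_arithmetic KE flow0 ff h0 r0 nR pR t0 A0 A2 (ltW nontriv) HG.
have rhsX : rhs <= X / (n%:R * h).
  apply: le_trans rate; rewrite /rhs lerB// ler_wpM2l//.
    by rewrite mulr_ge0// ltW.
  by rewrite lerD2r lerDl.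
rewrite subr_ge0.
apply: (@le_trans _ _ (X / (n%:R * h) * kappa_l K * N u ^+ 2)).
  rewrite -[leRHS]mulrA -[leLHS]mulrA ler_wpM2r//.
  by rewrite mulr_ge0 ?sqr_ge0// ltW.
apply: le_trans (bregman_ge hK h0 tau (fun i => ys i w)
  (fun i => colv (xs i w)) betastar u).
have -> : X / (n%:R * h) * kappa_l K * N u ^+ 2 =
    n%:R^-1 * (kappa_l K / h * N u ^+ 2 * X) by field; rewrite !gt_eqF.
rewrite ler_wpM2l ?invr_ge0//.
rewrite /X mulr_sumr; apply: ler_sum => i _.
have -> : dot v (W (Z i w)) = (N u)^-1 * dot (colv (xs i w)) u.
  by rewrite /v dotZl /W dot_mulmxr trmx_inv BT mulmxA mulVmx// mul1mx dotC.
have -> : kappa_l K / h * N u ^+ 2 * (chi (Z i w) *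
      truncsq (2 * m) ((N u)^-1 * dot (colv (xs i w)) u)) =
    chi (Z i w) * (kappa_l K / h) * (N u ^+ 2 *
      truncsq (2 * m) ((N u)^-1 * dot (colv (xs i w)) u)) by ring.
have chi0 : 0 <= chi (Z i w) by case: (chi01 (Z i w)) => ->.
have kh : 0 <= kappa_l K / h by rewrite divr_ge0// ltW.
rewrite [leRHS]mulrA ler_wpM2l ?(mulr_ge0 chi0 kh)//.
apply: truncsq_scale => //.
have -> : h / 2 = r * (2 * m) by rewrite /m; field; rewrite gt_eqF.
have m2 : 0 <= 2 * m by rewrite mulr_ge0// ltW.
by rewrite ler_wpM2r.
Qed.
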